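(* Consider the system $\dot x=f(x;\mu)+\epsilon g(x,\omega t)$, $x\in\mathbb{R}^2$, with the assumptions and notation of the context, and assume that $c\neq 0$ and $d\neq 0$. Then, by a local change of coordinates (depending on $\mu$, $\epsilon$ and $2\pi$-periodically on $\omega t$) and a constant rescaling of time, the system is transformed, when higher-order terms are ignored, into $$\dot y_1=y_2,\qquad \dot y_2=\nu_1y_1+\nu_2y_2+s_1y_1^3+s_2y_1^2y_2+\epsilon h(\bar\omega t),$$ where $$\nu_1=\left|\frac dc\right|^2(b_{211}\mu_1+b_{212}\mu_2),\qquad \nu_2=\left|\frac dc\right|\bigl((b_{111}+b_{221})\mu_1+(b_{112}+b_{222})\mu_2\bigr),$$ $$s_1=\operatorname{sign}c,\quad s_2=\operatorname{sign}d,\quad \bar\omega=\left|\frac dc\right|\omega,\quad h(\phi)=\frac{|d|^3}{|c|^{5/2}}\,g_{02}(\phi).$$ Moreover, $$\int_0^{2\pi}h(\phi)\,d\phi=0.$$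
   Context: Here $0<\epsilon\ll1$, $\omega>0$, $\mu=(\mu_1,\mu_2)\in\mathbb{R}^2$. The map $f=(f_1,f_2):\mathbb{R}^2\times\mathbb{R}^2\to\mathbb{R}^2$ is $C^4$, satisfies $f(-x;\mu)=-f(x;\mu)$, and $D_xf(0;0)=J:=\begin{pmatrix}0&1\\0&0\end{pmatrix}$. The map $g:\mathbb{R}^2\times\mathbb{R}\to\mathbb{R}^2$ is $C^2$, $g(x,\phi)$ is $2\pi$-periodic in $\phi$, and $\int_0^{2\pi}g(x,\phi)\,d\phi=0$ for every $x\in\mathbb{R}^2$. The frequency is small: $\omega=o(1)$ (the regime of interest is $\omega=O(\epsilon^{1/4})$). Notation: $a_{jkl}=\frac{\partial^3f_j}{\partial x_1^k\partial x_2^l}(0;0)$ with $l=3-k$, $k=0,1,2,3$; $b_{jkl}=\frac{\partial^2f_j}{\partial x_k\partial\mu_l}(0;0)$ for $k,l=1,2$; $c=\tfrac16a_{230}$; $d=\tfrac12(a_{221}+a_{130})$; $g_0(\phi)=g(0,\phi)=(g_{01}(\phi),g_{02}(\phi))$. ''Higher-order terms'' are terms of higher order than $O(|x|^3)$, $O(|\mu||x|)$ and $O(\epsilon)$ as $(x,\mu,\epsilon,\omega)\to0$. The time rescaling is $t\to|c/d|\,t$. *)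

(* Defs.v *)
From HB Require Import structures.
From mathcomp Require Export all_boot all_order all_algebra.
From mathcomp Require Export all_classical all_reals all_analysis.
Export Order.TTheory GRing.Theory Num.Theory numFieldNormedType.Exports.

Set Implicit Arguments.
Unset Strict Implicit.
Unset Printing Implicit Defensive.

Local Open Scope classical_set_scope.
Local Open Scope ring_scope.

(* Points of R^2 are row vectors; coordinates are numbered 0, 1 instead of
   1, 2, so the indices j, k, l of the mathematics are shifted by one whenever
   they number coordinates (but not when they are orders of derivation). *)

Section Smoothness.
Variables (R : realType) (V W : normedModType R).

(* Meant for an open U of a finite-dimensional space, where it is the usual
   class C^k: 'D_v f is of class C^(k-1) for every direction v. *)
Fixpoint Cclass_on (k : nat) (U : set V) (f : V -> W) : Prop :=
  if k is k'.+1 then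
    (forall x, U x -> differentiable f x) /\
    (forall v, Cclass_on k' U (fun x => 'D_v f x))
  else forall x, U x -> {for x, continuous f}.

Definition Cclass (k : nat) (f : V -> W) : Prop := Cclass_on k setT f.

End Smoothness.

Definition diffeo_on (R : realType) (V W : normedModType R) (k : nat)
    (U : set V) (F : V -> W) : Prop :=
  exists G : W -> V,
    [/\ open (F @` U), Cclass_on k U F, Cclass_on k (F @` U) G &
        forall x, U x -> G (F x) = x].

Section Coefficients.
Variable R : realType.
Local Notation V := 'rV[R]_2.

Definition pd_x (i : 'I_2) (F : V * V -> R) : V * V -> R :=
  fun p => 'D_((delta_mx 0 i, 0) : V * V) F p.

Definition pd_mu (i : 'I_2) (F : V * V -> R) : V * V -> R :=
  fun p => 'D_((0, delta_mx 0 i) : V * V) F p.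

Variable f : V * V -> V.

(* k and l are the orders of derivation in x_1 and x_2 *)
Definition coef_a (j : 'I_2) (k l : nat) : R :=
  iter k (pd_x 0) (iter l (pd_x 1) (fun p => f p 0 j)) (0, 0).

Definition coef_b (j k l : 'I_2) : R :=
  pd_x k (pd_mu l (fun p => f p 0 j)) (0, 0).

Definition coef_c : R := coef_a 1 3 0 / 6.
Definition coef_d : R := (coef_a 1 2 1 + coef_a 0 3 0) / 2.

Definition nu1 (mu : V) : R :=
  `|coef_d / coef_c| ^+ 2 *
    (coef_b 1 0 0 * mu 0 0 + coef_b 1 0 1 * mu 0 1).

Definition nu2 (mu : V) : R :=
  `|coef_d / coef_c| *
    ((coef_b 0 0 0 + coef_b 1 1 0) * mu 0 0 +
     (coef_b 0 0 1 + coef_b 1 1 1) * mu 0 1).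

Definition forcing (g : V * R -> V) (phi : R) : R :=
  `|coef_d| ^+ 3 / `|coef_c| `^ (5 / 2) * g (0, phi) 0 1.

Definition normal_form (g : V * R -> V) (mu : V) (eps phi : R) (y : V) : V :=
  \row_(i < 2)
    if i == 0 then y 0 1
    else nu1 mu * y 0 0 + nu2 mu * y 0 1
         + Num.sg coef_c * y 0 0 ^+ 3
         + Num.sg coef_d * y 0 0 ^+ 2 * y 0 1
         + eps * forcing g phi.

End Coefficients.

Definition solves_on (R : realType) (F : R -> 'rV[R]_2 -> 'rV[R]_2)
    (I : set R) (x : R -> 'rV[R]_2) : Prop :=
  forall t, I t -> is_derive t 1 x (F t (x t)).

Section ChangeOfCoordinates.
Variable R : realType.
Local Notation V := 'rV[R]_2.

(* points (x, (mu, eps, phi)) with x, mu, eps close to 0 and any phase phi *)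
Definition tube (r : R) : set (V * (V * R * R)) :=
  [set q | [/\ `|q.1| < r, `|q.2.1.1| < r & `|q.2.1.2| < r]].

(* y = Phi (x, (mu, eps, phi)) is, for fixed parameters and phase, a change of
   coordinates near the origin of the plane; the domain |x| < r is uniform in
   the parameters, and Phi and the inverse change are jointly C^2 (no more can
   be asked in general, since they involve the C^2 map g). *)
Definition local_coordinates (r : R) (Phi : V * (V * R * R) -> V) : Prop :=
  [/\ 0 < r,
      diffeo_on 2 (tube r) (fun q => (Phi q, q.2)),
      forall phi, Phi (0, (0, 0, phi)) = 0 &
      forall x mu eps phi, tube r (x, (mu, eps, phi)) ->
        Phi (x, (mu, eps, phi + 2 * pi)) = Phi (x, (mu, eps, phi))].

(* E y phi mu eps omega = o(|y|^3 + |mu||y| + eps) as (y, mu, eps, omega) -> 0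
   with eps, omega > 0, uniformly in the phase phi *)
Definition higher_order (E : V -> R -> V -> R -> R -> V) : Prop :=
  forall delta, 0 < delta -> exists2 r, 0 < r &
    forall y phi mu eps omega,
      `|y| < r -> `|mu| < r -> 0 < eps < r -> 0 < omega < r ->
      `|E y phi mu eps omega| <= delta * (`|y| ^+ 3 + `|mu| * `|y| + eps).

End ChangeOfCoordinates.

(* Main.v *)
From HB Require Import structures.
Require Import Defs.
From mathcomp Require Import ring lra.

Set Implicit Arguments.
Unset Strict Implicit.
Unset Printing Implicit Defensive.

Local Open Scope classical_set_scope.
Local Open Scope ring_scope.

(** Write [u], [v] for the coordinates of [x]. Up to higher-order terms the field
    is [(v + m0 u + m1 v + P(u, v) + eps g01, n0 u + n1 v + Q(u, v) + eps g02)],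
    where [m0], [m1], [n0], [n1] are linear in [mu] and [P], [Q] are cubic forms
    ([field_expansion]): oddness kills the quadratic terms, and expanding first
    in [v], then in [u], meets the partial derivatives in the very order in
    which the coefficients are defined.

    Looking for [y1 = u + p], with [p] a cubic form, and for [y2] equal to the
    velocity of [y1] forces [y2 = v + m0 u + m1 v + P + v p_u + eps g01]. The
    oscillating term of the first equation is thus absorbed in [y2], and only
    comes back in the second equation as [eps omega g01' = o(eps)]. The form [p]
    is chosen so that the second equation keeps only the monomials [u^3] and
    [u^2 v]. Instead of these polynomials the proof uses [new1] and [new2], which
    have the same jets but are composed of explicitly invertible maps: a factor
    [1 / sqrt(1 - 2 al u^2)] and two fractional linear maps, one in each variable.
    The inverse is given by [old1] and [old2], so that both changes are visibly of
    class C^2, on a tube that is uniform in the phase ([change_diffeo]).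

    Errors are measured by [N3 = |x|^3 + |mu||x| + |eps|]. Along the field
    [u' = v + O(N3)] and [v' = O(N3)]; hence the derivatives of the change with
    respect to [u] are needed to the order [N2 = |x|^2 + |mu|], but the other ones
    only to leading order ([first_equation], [second_equation]). The bounds are
    uniform in the phase because [g] and its derivative are continuous and
    periodic.

    The scales [lam1], [lam2], [kappa] turn the cubic coefficients into signs.
    Finally, a diffeomorphism fibred over the parameters carries solutions to
    solutions in both directions ([is_derive_transport]), so that the remainder
    can be defined as the transported field minus the normal form. *)

(** * Functions of class C^k *)

Section CkCalculus.
Variables (R : realType) (V : normedModType R).

Lemma near_eq_differentiable (W : normedModType R) (f g : V -> W) (x : V) :
  {near x, f =1 g} -> differentiable f x -> differentiable g x.
Proof.
move=> fg /diff_locallyP[dfc dfx].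
have gx : g \o shift x = cst (g x) + 'd f x +o_ 0 id.
  apply/eqaddoP => _/posnumP[e].
  move/eqaddoP: dfx => /(_ _ (gt0 e)).
  have : \forall h \near (0 : V), f (h + x) = g (h + x).
    by move: fg; rewrite (near_shift 0 x)/= subr0.
  rewrite -(nbhs_singleton fg); apply: filterS2 => h fgh.
  by rewrite !fctE/= fgh.
by apply/diff_locallyP; rewrite (diff_unique dfc gx).
Qed.

Lemma near_open (U : set V) (P : V -> Prop) (x : V) :
  open U -> U x -> (forall y, U y -> P y) -> \forall y \near x, P y.
Proof.
move=> Uo Ux UP; apply: (@filterS _ _ _ U) => //.
exact: open_nbhs_nbhs.
Qed.

Lemma Cclass_on_ext (W : normedModType R) k (U : set V) (f g : V -> W) :
  open U -> {in U, f =1 g} -> Cclass_on k U f -> Cclass_on k U g.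
Proof.
move=> Uo; elim: k f g => [|k IH] f g fg /=.
  move=> cf x Ux; have fgx : {near x, f =1 g}.
    by apply: (near_open Uo Ux) => y Uy; apply: fg; rewrite inE.
  rewrite /prop_for /continuous_at -(nbhs_singleton fgx).
  exact: cvg_trans (near_eq_cvg fgx) (cf x Ux).
move=> [df Df]; split => [x Ux|v].
  apply: near_eq_differentiable (df x Ux).
  by apply: (near_open Uo Ux) => y Uy; apply: fg; rewrite inE.
apply: IH (Df v) => x; rewrite inE => Ux; apply: near_eq_derive.
by apply: (near_open Uo Ux) => y Uy; apply: fg; rewrite inE.
Qed.

Lemma Cclass_on_sub (W : normedModType R) k (U U' : set V) (f : V -> W) :
  U' `<=` U -> Cclass_on k U f -> Cclass_on k U' f.
Proof.
move=> UU'; elim: k f => [|k IH] f /=; first by move=> cf x /UU'/cf.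
by move=> [df Df]; split => [x /UU'/df//|v]; apply: IH.
Qed.

Lemma Cclass_on_continuous (W : normedModType R) k (U : set V) (f : V -> W) :
  Cclass_on k U f -> forall x, U x -> {for x, continuous f}.
Proof.
case: k => [//|k] [df _] x Ux.
exact/differentiable_continuous/df.
Qed.

Lemma Cclass_on_pred (W : normedModType R) k (U : set V) (f : V -> W) :
  Cclass_on k.+1 U f -> Cclass_on k U f.
Proof.
elim: k f => [|k IH] f; first by move=> /Cclass_on_continuous.
by move=> [df Df]; split => // v; apply: IH.
Qed.

Lemma Cclass_on_cst (W : normedModType R) k (U : set V) (w : W) :
  Cclass_on k U (cst w).
Proof.
elim: k w => [|k IH] w /=; first by move=> x _; exact: cst_continuous.
split => [x _|v]; first exact: differentiable_cst.
rewrite (_ : (fun x => _) = cst 0) //.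
by apply/funext => x; rewrite derive_cst.
Qed.

Lemma Cclass_onD (W : normedModType R) k (U : set V) (f g : V -> W) : open U ->
  Cclass_on k U f -> Cclass_on k U g -> Cclass_on k U (fun x => f x + g x).
Proof.
move=> Uo; elim: k f g => [|k IH] f g /=.
  by move=> cf cg x Ux; apply: continuousD; [exact: cf|exact: cg].
move=> [df Df] [dg Dg]; split => [x Ux|v].
  by apply: differentiableD; [exact: df|exact: dg].
apply: (@Cclass_on_ext _ _ _ (fun x => 'D_v f x + 'D_v g x)) => //.
  move=> x; rewrite inE => Ux.
  by symmetry; apply: deriveD; apply: diff_derivable; [exact: df|exact: dg].
exact: IH.
Qed.

(** Post-composition with a continuous linear map. *)
Lemma derive_postlin (W W' : normedModType R) (L : {linear W -> W'})
    (f : V -> W) x v : continuous L -> differentiable f x ->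
  'D_v (fun y => L (f y)) x = L ('D_v f x).
Proof.
move=> Lc df; have dL y := linear_differentiable y Lc.
rewrite deriveE; last exact: (differentiable_comp df (dL _)).
rewrite (diff_comp df (dL _)) /= deriveE //.
by rewrite (diff_lin _ Lc).
Qed.

Lemma Cclass_on_postlin (W W' : normedModType R) (L : {linear W -> W'}) k
    (U : set V) (f : V -> W) : open U -> continuous L ->
  Cclass_on k U f -> Cclass_on k U (fun x => L (f x)).
Proof.
move=> Uo Lc; elim: k f => [|k IH] f /=.
  move=> cf x Ux; apply: continuous_comp (cf x Ux) _; exact: Lc.
move=> [df Df]; split => [x Ux|v].
  by apply: (differentiable_comp (df x Ux)); exact: linear_differentiable.
apply: (@Cclass_on_ext _ _ _ (fun x => L ('D_v f x))) (IH _ (Df v)) => //.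
by move=> x; rewrite inE => Ux; rewrite derive_postlin//; exact: df.
Qed.

(** Pre-composition with a continuous linear map. *)
Lemma Cclass_on_prelin (W W' : normedModType R) (L : {linear V -> W}) k
    (U : set V) (f : W -> W') : open U -> continuous L ->
  Cclass k f -> Cclass_on k U (fun x => f (L x)).
Proof.
move=> Uo Lc; rewrite /Cclass; elim: k f => [|k IH] f /=.
  move=> cf x Ux; apply: continuous_comp; [exact: Lc|exact: cf].
move=> [df Df]; have dL y := linear_differentiable y Lc; split => [x Ux|v].
  by apply: (differentiable_comp (dL x)); exact: (df _ I).
rewrite (_ : (fun x => _) = (fun x => 'D_(L v) f (L x))); first exact: (IH _ (Df (L v))).
apply/funext => x; rewrite deriveE; last first.
  by apply: (differentiable_comp (dL x)); exact: (df _ I).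
rewrite (diff_comp (dL x) (df _ I)) /= deriveE; last exact: (df _ I).
by rewrite (diff_lin _ Lc).
Qed.

Lemma Cclass_on_lin (W : normedModType R) (L : {linear V -> W}) k
    (U : set V) : continuous L -> Cclass_on k U L.
Proof.
move=> Lc; case: k => [|k] /=; first by move=> x _; exact: Lc.
split => [x _|v]; first exact: linear_differentiable.
rewrite (_ : (fun x => _) = cst (L v)); first exact: Cclass_on_cst.
apply/funext => x; rewrite deriveE; last exact: linear_differentiable.
by rewrite (diff_lin _ Lc).
Qed.

Lemma Cclass_onM k (U : set V) (f g : V -> R) : open U ->
  Cclass_on k U f -> Cclass_on k U g -> Cclass_on k U (fun x => f x * g x).
Proof.
move=> Uo; elim: k f g => [|k IH] f g.
  by move=> cf cg x Ux; apply: continuousM; [exact: cf|exact: cg].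
move=> fk gk; have [df Df] := fk; have [dg Dg] := gk; split => [x Ux|v].
  by apply: differentiableM; [exact: df|exact: dg].
apply: (@Cclass_on_ext _ _ _ (fun x => f x * 'D_v g x + g x * 'D_v f x)) => //.
  move=> x; rewrite inE => Ux.
  by symmetry; apply: deriveM; apply: diff_derivable; [exact: df|exact: dg].
by apply: Cclass_onD => //; apply: IH => //; try exact: Cclass_on_pred; [exact: Dg|exact: Df].
Qed.

Lemma Cclass_onN k (U : set V) (f : V -> R) : open U ->
  Cclass_on k U f -> Cclass_on k U (fun x => - f x).
Proof.
move=> Uo fk; rewrite (_ : (fun x => _) = (fun x => cst (-1) x * f x)).
  by apply: Cclass_onM => //; exact: Cclass_on_cst.
by apply/funext => x; rewrite mulN1r.
Qed.

Lemma Cclass_onV k (U : set V) (f : V -> R) : open U ->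
  (forall x, U x -> f x != 0) ->
  Cclass_on k U f -> Cclass_on k U (fun x => (f x)^-1).
Proof.
move=> Uo f0; elim: k => [|k IH].
  by move=> cf x Ux; apply: continuousV; [exact: f0|exact: cf].
move=> fk; have [df Df] := fk; split => [x Ux|v].
  by apply: differentiableV; [exact: df|exact: f0].
apply: (@Cclass_on_ext _ _ _ (fun x => - ((f x)^-1 * (f x)^-1 * 'D_v f x))) => //.
  move=> x; rewrite inE => Ux.
  rewrite deriveV ?f0//; last exact/diff_derivable/df.
  by rewrite -expr2 -exprVn /GRing.scale/= mulNr.
have fVk := IH (Cclass_on_pred fk).
apply: Cclass_onN => //; apply: Cclass_onM; [by []| |exact: Df].
exact: Cclass_onM.
Qed.

Lemma differentiable_sqrt_comp (f : V -> R) x : 0 < f x -> differentiable f x ->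
  differentiable (fun y => Num.sqrt (f y)) x.
Proof.
move=> f0 df; apply: (differentiable_comp df).
by apply/derivable1_diffP; have [] := is_derive1_sqrt f0.
Qed.

Lemma derive_sqrt_comp (f : V -> R) x v : 0 < f x -> differentiable f x ->
  'D_v (fun y => Num.sqrt (f y)) x = (2 * Num.sqrt (f x))^-1 * 'D_v f x.
Proof.
move=> f0 df; have df' := differentiable_sqrt_comp f0 df.
have dsq : differentiable (@Num.sqrt R) (f x).
  by apply/derivable1_diffP; have [] := is_derive1_sqrt f0.
rewrite deriveE // (diff_comp df dsq) /= -(deriveE v df).
rewrite -[X in 'd _ _ X]mulr1 [LHS]linearZ /= -deriveE//.
by rewrite derive_sqrt//; exact: mulrC.
Qed.

Lemma Cclass_on_sqrt k (U : set V) (f : V -> R) : open U ->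
  (forall x, U x -> 0 < f x) ->
  Cclass_on k U f -> Cclass_on k U (fun x => Num.sqrt (f x)).
Proof.
move=> Uo f0; elim: k => [|k IH].
  move=> cf x Ux; apply: (continuous_comp (cf x Ux)); exact: sqrt_continuous.
move=> fk; have [df Df] := fk; split => [x Ux|v].
  by apply: differentiable_sqrt_comp; [exact: f0|exact: df].
apply: (@Cclass_on_ext _ _ _ (fun x => (2 * Num.sqrt (f x))^-1 * 'D_v f x)) => //.
  move=> x; rewrite inE => Ux.
  by rewrite derive_sqrt_comp ?f0//; exact: df.
have fSk := IH (Cclass_on_pred fk).
apply: Cclass_onM; [by []| |exact: Df]; apply: Cclass_onV => // [x Ux|].
  by rewrite mulf_neq0// gt_eqF// sqrtr_gt0 f0.
by apply: Cclass_onM => //; exact: Cclass_on_cst.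
Qed.

End CkCalculus.

Section LinearMaps.
Variable R : realType.

Lemma fst_continuous (V W : normedModType R) : continuous (@fst V W).
Proof. by move=> p; exact: cvg_fst. Qed.

Lemma snd_continuous (V W : normedModType R) : continuous (@snd V W).
Proof. by move=> p; exact: cvg_snd. Qed.

(** Coordinates of a row vector, as bundled linear maps. *)
Definition coord (n : nat) (j : 'I_n) (x : 'rV[R]_n) : R := x 0 j.

Fact coord_linear n (j : 'I_n) : linear (coord j).
Proof. by move=> a x y; rewrite /coord !mxE. Qed.

HB.instance Definition _ n (j : 'I_n) :=
  GRing.isLinear.Build R 'rV[R]_n R *%R (coord j) (coord_linear j).

Lemma coord_lin_continuous n (j : 'I_n) : continuous (coord j).
Proof. exact: coord_continuous. Qed.

(** The two injections into a product. *)
Definition inj1 (V W : normedModType R) (v : V) : V * W := (v, 0).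
Definition inj2 (V W : normedModType R) (w : W) : V * W := (0, w).

Fact inj1_linear (V W : normedModType R) : linear (@inj1 V W).
Proof. by move=> a x y; rewrite /inj1 -[RHS]/(_, a *: 0 + 0) scaler0 addr0. Qed.
Fact inj2_linear (V W : normedModType R) : linear (@inj2 V W).
Proof. by move=> a x y; rewrite /inj2 -[RHS]/(a *: 0 + 0, _) scaler0 addr0. Qed.

HB.instance Definition _ (V W : normedModType R) :=
  GRing.isLinear.Build R V (V * W)%type *:%R (@inj1 V W) (@inj1_linear V W).
HB.instance Definition _ (V W : normedModType R) :=
  GRing.isLinear.Build R W (V * W)%type *:%R (@inj2 V W) (@inj2_linear V W).

Lemma inj1_continuous (V W : normedModType R) : continuous (@inj1 V W).
Proof. by move=> x; apply: cvg_pair; [exact: cvg_id|exact: cvg_cst]. Qed.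
Lemma inj2_continuous (V W : normedModType R) : continuous (@inj2 V W).
Proof. by move=> x; apply: cvg_pair; [exact: cvg_cst|exact: cvg_id]. Qed.

(** The linear embedding of [R] as a coordinate axis. *)
Definition axis (n : nat) (j : 'I_n) (a : R) : 'rV[R]_n := a *: delta_mx 0 j.

Fact axis_linear n (j : 'I_n) : linear (axis j : R^o -> _).
Proof. by move=> a x y; rewrite /axis scalerDl scalerA. Qed.

HB.instance Definition _ n (j : 'I_n) :=
  GRing.isLinear.Build R R^o 'rV[R]_n *:%R (axis j : R^o -> _) (axis_linear j).

Lemma axis_continuous n (j : 'I_n) : continuous (axis j).
Proof. exact: scalel_continuous. Qed.

Lemma Cclass_on_pair (U V W : normedModType R) k (D : set U) (f : U -> V)
    (g : U -> W) : open D -> Cclass_on k D f -> Cclass_on k D g ->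
  Cclass_on k D (fun x => (f x, g x)).
Proof.
move=> Do fk gk.
rewrite (_ : (fun x => _) = (fun x => inj1 W (f x) + inj2 V (g x))).
  apply: Cclass_onD => //; apply: Cclass_on_postlin => //.
    exact: inj1_continuous.
  exact: inj2_continuous.
by apply/funext => x; apply/pair_equal_spec; rewrite addr0 add0r.
Qed.

Lemma Cclass_on_row2 (U : normedModType R) k (D : set U) (f g : U -> R) :
  open D -> Cclass_on k D f -> Cclass_on k D g ->
  Cclass_on k D (fun x => \row_(i < 2) if i == 0 then f x else g x).
Proof.
move=> Do fk gk.
rewrite (_ : (fun x => _) = (fun x => axis (0 : 'I_2) (f x) + axis 1 (g x))).
  by apply: Cclass_onD => //; apply: Cclass_on_postlin => //; exact: axis_continuous.
apply/funext => x; apply/rowP; case=> -[|[|//]] i; rewrite !mxE/=.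
  by rewrite mulr0 mulr1 addr0.
by rewrite mulr0 mulr1 add0r.
Qed.

End LinearMaps.

(** * Curves and transport of velocities *)

Section Curves.
Variable R : realType.

Lemma is_derive_curve_comp (W W' : normedModType R) (h : W -> W') (c : R -> W)
    (t : R) (v : W) : differentiable h (c t) -> is_derive t 1 c v ->
  is_derive t 1 (fun s => h (c s)) ('D_v h (c t)).
Proof.
move=> dh [dc cv]; have dc' : differentiable c t by apply/derivable1_diffP.
have dhc : differentiable (h \o c) t by exact: differentiable_comp.
apply: DeriveDef; first exact/derivable1_diffP.
by rewrite deriveE// (diff_comp dc' dh)/= -(deriveE _ dc') cv deriveE.
Qed.

Lemma is_derive_pair (V W W' : normedModType R) (a : V -> W) (b : V -> W')
    (x v : V) (a' : W) (b' : W') :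
  is_derive x v a a' -> is_derive x v b b' ->
  is_derive x v (fun s => (a s, b s)) (a', b').
Proof.
move=> [da <-] [db <-].
have cab : (fun h : R => h^-1 *: (((fun s => (a s, b s)) \o shift x) (h *: v)
     - (a x, b x))) @ 0^' --> ('D_v a x, 'D_v b x).
  exact: (cvg_pair da db).
by apply: DeriveDef; [apply/cvg_ex; eexists; exact: cab|exact: cvg_lim cab].
Qed.

Lemma is_derive_fst (W W' : normedModType R) (c : R -> W * W') (t : R)
    (w : W * W') : is_derive t 1 c w -> is_derive t 1 (fun s => (c s).1) w.1.
Proof.
have dfst p := linear_differentiable p (@fst_continuous R W W').
move=> cw; have := is_derive_curve_comp (dfst (c t)) cw.
by rewrite deriveE// (diff_lin _ (@fst_continuous R W W')).
Qed.

Lemma is_derive_rescale (W : normedModType R) (c : R -> W) (k t : R) (w : W) :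
  is_derive (t * k) 1 c w -> is_derive t 1 (fun s => c (s * k)) (k *: w).
Proof.
move=> [dc <-].
have dk : is_derive t 1 (fun s : R => s * k) k.
  have := is_deriveM (is_derive_id t (1 : R)) (is_derive_cst k t (1 : R)).
  by rewrite scaler0 add0r /GRing.scale/= mulr1.
have dc' : differentiable c (t * k) by apply/derivable1_diffP.
have := is_derive_curve_comp (c := fun s => s * k) dc' dk.
rewrite deriveE// -[X in 'd _ _ X]mulr1 [X in is_derive _ _ _ X]linearZ/=.
by rewrite -deriveE.
Qed.

Section Transport.
Variables (V P : normedModType R) (U : set (V * P)) (Phi : V * P -> V)
  (G : V * P -> V * P).
Let F (q : V * P) : V * P := (Phi q, q.2).
Hypotheses (Uo : open U) (dF : forall q, U q -> differentiable F q)
  (dG : forall q, U q -> differentiable G (F q)) (FK : {in U, cancel F G}).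

Let dPhi q : U q -> differentiable Phi q.
Proof.
move=> Uq; have dfst x := linear_differentiable x (@fst_continuous R V P).
exact: (@differentiable_comp _ _ _ _ F fst q (dF Uq) (dfst _)).
Qed.

Let derive_F q v p : U q -> 'D_(v, p) F q = ('D_(v, p) Phi q, p).
Proof.
move=> Uq; have dsnd x := linear_differentiable x (@snd_continuous R V P).
rewrite deriveE; last exact: dF.
rewrite /F diff_pair//=; last exact: dPhi.
by rewrite -deriveE ?(diff_lin _ (@snd_continuous R V P))//; exact: dPhi.
Qed.

Let derive_G q v p : U q -> 'D_('D_(v, p) Phi q, p) G (F q) = (v, p).
Proof.
move=> Uq; rewrite -derive_F// (deriveE _ (dF Uq)) (deriveE _ (dG Uq)).
rewrite -[LHS]/(('d G (F q) \o 'd F q) (v, p)) -(diff_comp (dF Uq) (dG Uq)).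
rewrite -deriveE; last exact: differentiable_comp (dF Uq) (dG Uq).
rewrite (@near_eq_derive _ _ _ _ id); first exact: derive_id.
by apply: (near_open Uo Uq) => q' Uq'; apply: FK; rewrite inE.
Qed.

(** A local diffeomorphism fibred over the parameters carries the velocity
    [v] of a curve to the velocity ['D_(v, p') Phi], and only that one. *)
Lemma is_derive_transport (x : R -> V) (p : R -> P) (t : R) (v : V) (p' : P) :
  (\forall s \near t, U (x s, p s)) -> is_derive t 1 p p' ->
  is_derive t 1 x v <->
  is_derive t 1 (fun s => Phi (x s, p s)) ('D_(v, p') Phi (x t, p t)).
Proof.
move=> Ux dp; have Ut := nbhs_singleton Ux; split => dx.
  by apply: is_derive_curve_comp; [exact: dPhi|exact: is_derive_pair].
have dy := is_derive_pair dx dp.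
have := is_derive_curve_comp (dG Ut) dy; rewrite derive_G// => dGy.
apply: (near_eq_is_derive _ (is_derive_fst dGy)).
near=> s; rewrite -[X in G X]/(F (x s, p s)) FK// inE.
by near: s.
Unshelve. all: by end_near. Qed.

End Transport.
End Curves.

(** * Functions periodic in the phase *)

Section Periodic.
Variables (R : realType) (V W : normedModType R).

(** Every phase can be replaced by one in [0, 2 pi], for all values of the first
    argument at once. *)
Lemma periodic_representative (T T' : Type) (h : T * R -> T') :
  (forall x phi, h (x, phi + 2 * pi) = h (x, phi)) ->
  forall phi, exists2 psi, 0 <= psi <= 2 * pi & forall x, h (x, phi) = h (x, psi).
Proof.
move=> per phi; have p0 : 0 < 2 * pi :> R by rewrite mulr_gt0// pi_gt0.
have perN n x psi : h (x, psi + n%:R * (2 * pi)) = h (x, psi).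
  elim: n psi => [|n IH] psi; first by rewrite mul0r addr0.
  by rewrite -addn1 natrD mulrDl mul1r addrA per IH.
have perZ (n : int) x psi : h (x, psi + n%:~R * (2 * pi)) = h (x, psi).
  case: n => n; first exact: perN.
  by rewrite NegzE mulrNz mulNr -(perN n.+1) subrK.
pose n := Num.floor (phi / (2 * pi)).
exists (phi - n%:~R * (2 * pi)); last first.
  by move=> x; rewrite -[LHS](perZ (- n)) mulrNz mulNr.
have := Num.Theory.floor_itv (phi / (2 * pi)).
rewrite -/n => /andP[n1 n2]; apply/andP; split.
  by rewrite subr_ge0 -ler_pdivlMr.
move: n2; rewrite ltr_pdivrMr// intrD mulrDl mul1r => /ltW n2.
by rewrite lerBlDr addrC.
Qed.

Variable h : V * R -> W.
Hypotheses (h_cont : continuous h)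
  (h_per : forall x phi, h (x, phi + 2 * pi) = h (x, phi)).

(** Continuity at 0 in the first variable is uniform in the phase, by compactness of
    a period. *)
Lemma periodic_uniformly_continuous0 (delta : R) : 0 < delta ->
  \forall x \near 0, forall phi, `|h (x, phi) - h (0, phi)| <= delta.
Proof.
move=> d0; have /compact_near_coveringP cov := @segment_compact R 0 (2 * pi).
have {}cov := cov V (nbhs (0 : V))
  (fun x phi => `|h (x, phi) - h (0, phi)| <= delta) (nbhs_filter _).
apply: filterS (cov _).
  move=> x hx phi; have [psi psi_in hE] := periodic_representative h_per phi.
  by rewrite !hE; apply: hx; rewrite /= in_itv.
move=> phi0 _.
have c1 : h (p.2, p.1) @[p --> (phi0, 0 : V)] --> h (0, phi0).
  apply: (@cvg_comp _ _ _ (fun p : R * V => (p.2, p.1)) h _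
    (nbhs (0 : V, phi0))); last exact: h_cont.
  by apply: (@cvg_pair _ _ _ _ (nbhs (0 : V)) (nbhs phi0)) => /=; [exact: cvg_snd|exact: cvg_fst].
have c2 : h (0, p.1) @[p --> (phi0, 0 : V)] --> h (0, phi0).
  apply: (@cvg_comp _ _ _ (fun p : R * V => (0 : V, p.1)) h _
    (nbhs (0 : V, phi0))); last exact: h_cont.
  by apply: (@cvg_pair _ _ _ _ (nbhs (0 : V)) (nbhs phi0)) => /=; [exact: cvg_cst|exact: cvg_fst].
have := cvgB c1 c2; rewrite subrr => /(_ (nbhs_filter _)) /cvgr0Pnorm_le /(_ _ d0).
by [].
Qed.

Lemma periodic_bounded : exists2 M : R, 0 < M & forall phi, `|h (0, phi)| <= M.
Proof.
have [||c _ cmax] := @EVT_max R (fun phi => `|h (0, phi)|) 0 (2 * pi).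
- by rewrite mulr_ge0// pi_ge0.
- apply: continuous_subspaceT => phi.
  have c1 : (0 : V, psi) @[psi --> phi] --> (0 : V, phi).
    by apply: (@cvg_pair _ _ _ _ (nbhs (0 : V)) (nbhs phi)) => /=; [exact: cvg_cst|exact: cvg_id].
  have c2 := cvg_comp _ h c1 (@h_cont (0, phi)).
  exact: cvg_norm c2.
exists (`|h (0, c)| + 1) => [|phi]; first by rewrite ltr_wpDl.
have [psi psi_in hE] := periodic_representative h_per phi.
by rewrite hE (le_trans (cmax psi _))// ?lerDl// in_itv.
Qed.

End Periodic.

(** * Taylor expansion of an odd planar vector field *)

Section Taylor.
Variable R : realType.
Local Notation V := 'rV[R]_2.

(** Mean value inequality for the deviation from a linear function. *)
Lemma mean_value_bound (h dh : R -> R) (L K t : R) :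
  (forall s : R, `|s| <= `|t| -> is_derive s 1 h (dh s)) ->
  (forall s, `|s| <= `|t| -> `|dh s - L| <= K) ->
  `|h t - h 0 - L * t| <= K * `|t|.
Proof.
move=> hdh hK.
have small s : 0 <= s <= 1 -> `|s * t| <= `|t|.
  move=> /andP[s0 s1]; rewrite normrM ger0_norm//.
  by rewrite ler_piMl.
have dg (s : R) : 0 <= s <= 1 -> is_derive s 1 (fun s => h (s * t)) (t *: dh (s * t)).
  by move=> s01; apply: is_derive_rescale; apply: hdh; exact: small.
(* Rescaling to the unit interval treats both signs of [t] at once. *)
have [|||c c01] := @MVT_segment R (fun s => h (s * t)) (fun s => t * dh (s * t)) 0 1.
- by [].
- move=> s; rewrite in_itv/= => /andP[s0 s1]; apply: dg; by rewrite !ltW.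
- apply: derivable_within_continuous => s; rewrite in_itv/= => s01.
  by have [] := dg s s01.
rewrite mul0r mul1r subr0 mulr1 => ->.
rewrite mulrC -mulrBl normrM ler_wpM2r// hK// small//.
Qed.

Lemma is_derive_monomial (a s : R) (n : nat) :
  is_derive s 1 (fun u => a * u ^+ n) (a * (n%:R * s ^+ n.-1)).
Proof.
have dn : is_derive s 1 (@GRing.exp R ^~ n) (n%:R * s ^+ n.-1).
  apply: DeriveDef; first exact: exprn_derivable.
  by rewrite exp_derive /GRing.scale/= mulr1.
exact: (is_deriveZ a dn).
Qed.

(** Taylor's formula for a chain [h 0], [h 1], ... of successive derivatives, the remainder
    being controlled by the oscillation of the last one. *)
Lemma taylor_bound (n : nat) (h : nat -> R -> R) (K t : R) :
  (forall i (s : R), (i < n)%N -> is_derive s 1 (h i) (h i.+1 s)) ->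
  (forall s, `|s| <= `|t| -> `|h n s - h n 0| <= K) ->
  `|h 0%N t - \sum_(i < n.+1) h i 0 / i`!%:R * t ^+ i| <= K * `|t| ^+ n.
Proof.
elim: n h t => [|n IH] h t hd hK.
  by rewrite big_ord1/= fact0 divr1 expr0 !mulr1; exact: hK.
pose q s := \sum_(i < n.+2) h i 0 / i`!%:R * s ^+ i.
pose dq s := \sum_(i < n.+1) h i.+1 0 / i`!%:R * s ^+ i.
have q0 : q 0 = h 0%N 0.
  rewrite /q big_ord_recl/= fact0 divr1 expr0 mulr1 big1 ?addr0// => i _.
  by rewrite /= exprS mul0r mulr0.
have dqE (s : R) : is_derive s 1 q (dq s).
  have dX (i : 'I_n.+2) : is_derive s 1 (fun s => h i 0 / i`!%:R * s ^+ i)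
      (h i 0 / i`!%:R * (i%:R * s ^+ i.-1)).
    exact: is_derive_monomial.
  have ds := is_derive_sum dX.
  rewrite (_ : q = \sum_(i < n.+2) (fun u => h i 0 / i`!%:R * u ^+ i)); last first.
    by apply/funext => u; rewrite fct_sumE.
  apply: (is_derive_eq ds).
  rewrite big_ord_recl/= mul0r mulr0 add0r; apply: eq_bigr => i _.
  rewrite /= /bump/= add1n factS natrM.
  have i0 : (i : nat).+1%:R != 0 :> R by rewrite pnatr_eq0.
  have f0 : (i : nat)`!%:R != 0 :> R by rewrite pnatr_eq0 -lt0n fact_gt0.
  by field; rewrite f0 addrC natr1 i0.
have /(_ (h 1%N \- dq) 0 (K * `|t| ^+ n)) := @mean_value_bound (h 0%N \- q).
move=> /(_ t) mv.
rewrite exprSr mulrA.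
have -> : h 0%N t - \sum_(i < n.+2) h i 0 / i`!%:R * t ^+ i =
    (h 0%N \- q) t - (h 0%N \- q) 0 - 0 * t.
  by rewrite /= q0 subrr subr0 mul0r subr0.
apply: mv => s st; first by have hs := hd 0%N s isT; exact: is_deriveB.
rewrite subr0.
apply: le_trans (IH (fun i => h i.+1) s _ _) _.
- by move=> i u i_n; exact: hd.
- by move=> u us; apply: hK; exact: le_trans us st.
have K0 : 0 <= K by apply: le_trans (hK 0 _); rewrite ?normr0.
by rewrite ler_wpM2l// lerXn2r// nnegrE.
Qed.

End Taylor.

Section TaylorPlane.
Variable R : realType.
Local Notation V := 'rV[R]_2.

Lemma norm_coord_le (n : nat) (x : 'rV[R]_n) (j : 'I_n) : `|x 0 j| <= `|x|.
Proof.
rewrite [leRHS]/Num.Def.normr/= mx_normrE.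
exact: (le_bigmax _ (fun ij => `|x ij.1 ij.2|) (0, j)).
Qed.

Lemma norm_row2_le (x : V) (a : R) : `|x 0 0| <= a -> `|x 0 1| <= a -> `|x| <= a.
Proof.
move=> x0 x1; have a0 : 0 <= a := le_trans (normr_ge0 _) x0.
rewrite [leLHS]/Num.Def.normr/= mx_normrE; apply: bigmax_le => // -[i j] _ /=.
rewrite (ord1 i); case: j => -[|[|//]] j.
  by rewrite (_ : Ordinal j = 0)//; exact: val_inj.
by rewrite (_ : Ordinal j = 1)//; exact: val_inj.
Qed.

Lemma is_derive_line (W : normedModType R) (a v : W) (s : R) :
  is_derive s 1 (fun u : R => a + u *: v) v.
Proof.
have dl : is_derive s 1 (fun u : R => u *: v) v.
  have [dsc sc] : is_diff s (fun u : R => u *: v) (fun u : R => u *: v).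
    exact: is_diff_scalel.
  apply: DeriveDef; first exact/derivable1_diffP.
  by rewrite deriveE// sc scale1r.
by have := is_deriveD (is_derive_cst a s (1 : R)) dl; rewrite add0r.
Qed.

Lemma Cclass_iter (W W' : normedModType R) (v : W) n i (G : W -> W') :
  Cclass (i + n) G -> Cclass n (iter i (fun H p => 'D_v H p) G).
Proof.
elim: i G => [//|i IH] G CG; rewrite iterSr; apply: IH.
by case: CG => _ /(_ v).
Qed.

Lemma Cclass_le (W W' : normedModType R) m n (G : W -> W') :
  (m <= n)%N -> Cclass n G -> Cclass m G.
Proof.
move=> mn; rewrite -(subnK mn); elim: (n - m)%N => [//|k IH] CG.
by apply: IH; exact: Cclass_on_pred.
Qed.

Lemma Cclass_differentiable (W W' : normedModType R) n (G : W -> W') p :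
  Cclass n.+1 G -> differentiable G p.
Proof. by case=> /(_ p I). Qed.

Lemma taylor_line (W : normedModType R) (G : W -> R) (a v : W) n (K t : R) :
  Cclass n G ->
  (forall s, `|s| <= `|t| -> `|iter n (fun H p => 'D_v H p) G (a + s *: v)
      - iter n (fun H p => 'D_v H p) G a| <= K) ->
  `|G (a + t *: v) - \sum_(i < n.+1)
      iter i (fun H p => 'D_v H p) G a / i`!%:R * t ^+ i| <= K * `|t| ^+ n.
Proof.
move=> CG GK.
pose h i s := iter i (fun H p => 'D_v H p) G (a + s *: v).
have h0 i : h i 0 = iter i (fun H p => 'D_v H p) G a by rewrite /h scale0r addr0.
under eq_bigr do rewrite -h0.
apply: (@taylor_bound _ _ h) => [i s i_n|s st]; last by rewrite h0 GK.
have Ci : Cclass 1 (iter i (fun H p => 'D_v H p) G).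
  by apply: Cclass_iter; rewrite addn1; exact: Cclass_le CG.
rewrite /h iterS.
exact: is_derive_curve_comp (Cclass_differentiable _ Ci) (is_derive_line _ _ _).
Qed.

(** The point of coordinates [x1], [x2], with vanishing parameters. *)
Definition pt (x1 x2 : R) : V * V :=
  (x1 *: delta_mx 0 0 + x2 *: delta_mx 0 1, 0).

Lemma ptE (x : V) : (x, 0) = pt (x 0 0) (x 0 1).
Proof.
congr pair; apply/rowP; case=> -[|[|//]] i; rewrite !mxE/=.
  by rewrite mulr1 mulr0 addr0; congr (x _ _); exact: val_inj.
by rewrite mulr1 mulr0 add0r; congr (x _ _); exact: val_inj.
Qed.

Lemma norm_pt (x1 x2 a : R) : `|x1| <= a -> `|x2| <= a -> `|pt x1 x2| <= a.
Proof.
move=> h1 h2; have a0 : 0 <= a := le_trans (normr_ge0 _) h1.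
rewrite prod_normE/= normr0 ge_max a0 andbT.
by apply: norm_row2_le; rewrite !mxE/= ?mulr1 ?mulr0 ?addr0 ?add0r.
Qed.

Lemma taylor_row (G : V * V -> R) n (K x1 : R) : Cclass n G ->
  (forall s, `|s| <= `|x1| ->
    `|iter n (pd_x 0) G (pt s 0) - iter n (pd_x 0) G 0| <= K) ->
  `|G (pt x1 0) - \sum_(k < n.+1) iter k (pd_x 0) G 0 / k`!%:R * x1 ^+ k|
    <= K * `|x1| ^+ n.
Proof.
have E s : pt s 0 = 0 + s *: (delta_mx 0 0, 0).
  by rewrite /pt add0r -[RHS]/(_ *: _, _ *: _) scale0r addr0 scaler0.
by move=> CG GK; rewrite E; apply: taylor_line => // s /GK; rewrite E.
Qed.

Lemma taylor_col (G : V * V -> R) n (K x1 x2 : R) : Cclass n G ->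
  (forall s, `|s| <= `|x2| ->
    `|iter n (pd_x 1) G (pt x1 s) - iter n (pd_x 1) G (pt x1 0)| <= K) ->
  `|G (pt x1 x2) - \sum_(l < n.+1) iter l (pd_x 1) G (pt x1 0) / l`!%:R * x2 ^+ l|
    <= K * `|x2| ^+ n.
Proof.
have E s : pt x1 s = pt x1 0 + s *: (delta_mx 0 1, 0).
  rewrite /pt -[RHS]/(_ + _ *: _, 0 + _ *: _).
  by rewrite scale0r !addr0 scaler0 addr0.
by move=> CG GK; rewrite [in X in G X]E; apply: taylor_line => // s /GK;
  rewrite [in X in _ X - _]E.
Qed.

End TaylorPlane.

Section Expansion.
Variable R : realType.
Local Notation V := 'rV[R]_2.

(** Third Taylor polynomial; [a k l] stands for the derivative of order [k] in [x1]
    and [l] in [x2] at the origin. *)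
Definition taylor3 (a : nat -> nat -> R) (x1 x2 : R) : R :=
  \sum_(l < 4) (\sum_(k < (3 - l).+1) a k l / k`!%:R * x1 ^+ k) / l`!%:R * x2 ^+ l.

Lemma taylor3_odd_part (a : nat -> nat -> R) (u v : R) :
  (taylor3 a u v - taylor3 a (- u) (- v)) / 2 =
  a 1%N 0%N * u + a 0%N 1%N * v + a 3%N 0%N / 6 * u ^+ 3
    + a 2%N 1%N / 2 * u ^+ 2 * v + a 1%N 2%N / 2 * u * v ^+ 2
    + a 0%N 3%N / 6 * v ^+ 3.
Proof.
rewrite /taylor3 !big_ord_recl !big_ord0 /= !(_ : forall n, bump 0 n = n.+1)//.
rewrite !(expr0, expr1, addr0, mulr1).
rewrite (_ : 0`! = 1)%N// (_ : 1`! = 1)%N// (_ : 2`! = 2)%N// (_ : 3`! = 6)%N//.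
by field.
Qed.
Variable F : V * V -> R.
Hypothesis F_C3 : Cclass 3 F.

Let a k l := iter k (pd_x 0) (iter l (pd_x 1) F) 0.

(** Taylor's formula in [x2] from the axis [x2 = 0], then in [x1] along that axis: only
    derivatives of the form [d_1^k d_2^l] occur. *)
Lemma taylor_plane (delta : R) : 0 < delta -> \forall x \near (0 : V),
  `|F (x, 0) - taylor3 a (x 0 0) (x 0 1)| <= delta * `|x| ^+ 3.
Proof.
move=> d0; have [e d8 ->] : exists2 e, 0 < e & delta = 8 * e.
  by exists (delta / 8); [rewrite divr_gt0|field].
have Cl l : (l <= 3)%N -> Cclass (3 - l) (iter l (pd_x 1) F).
  by move=> l3; apply: Cclass_iter; rewrite subnKC.
have Ac (l : 'I_4) : {for 0, continuous (iter (3 - l) (pd_x 0) (iter l (pd_x 1) F))}.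
  have : Cclass 0 (iter (3 - l) (pd_x 0) (iter l (pd_x 1) F)).
    by apply: Cclass_iter; rewrite addn0; apply: Cl; rewrite -ltnS.
  by move=> /(_ 0 I).
have : \forall p \near (0 : V * V), forall l : 'I_4,
    `|iter (3 - l) (pd_x 0) (iter l (pd_x 1) F) p - a (3 - l) l| <= e.
  apply: (@filter_forall (V * V)%type 'I_4 (fun l p =>
    `|iter (3 - l) (pd_x 0) (iter l (pd_x 1) F) p - a (3 - l) l| <= e) _ (nbhs_filter _)) => l.
  have /cvgrPdist_le/(_ _ d8) := Ac l.
  by apply: filterS => p; rewrite distrC.
move=> /nbhs_ballP[r r0 rP].
apply/nbhs_ballP; exists r => // x; rewrite -ball_normE/= sub0r normrN => xr.
have close (l : 'I_4) s1 s2 : `|s1| <= `|x| -> `|s2| <= `|x| ->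
    `|iter (3 - l) (pd_x 0) (iter l (pd_x 1) F) (pt s1 s2) - a (3 - l) l| <= e.
  move=> s1x s2x; apply: rP; rewrite -ball_normE/= sub0r normrN.
  by apply: le_lt_trans xr; exact: norm_pt.
have x0 := norm_coord_le x 0; have x1 := norm_coord_le x 1.
rewrite ptE /taylor3; set u := x 0 0 in x0 *; set v := x 0 1 in x1 *.
have rows (l : 'I_4) : `|iter l (pd_x 1) F (pt u 0) -
    \sum_(k < (3 - l).+1) a k l / k`!%:R * u ^+ k| <= e * `|u| ^+ (3 - l).
  apply: taylor_row => [|s su]; first by apply: Cl; rewrite -ltnS.
  by apply: close; [exact: le_trans su x0|rewrite normr0].
have col : `|F (pt u v) - \sum_(l < 4) iter l (pd_x 1) F (pt u 0) / l`!%:R * v ^+ l|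
    <= (e + e) * `|v| ^+ 3.
  apply: taylor_col => // s sv.
  rewrite -[X in `|X|](subrKA (a 0 3)); apply: le_trans (ler_normD _ _) _.
  have s_x := le_trans sv x1.
  apply: lerD; first by have := close ord_max u s x0 s_x.
  by rewrite distrC; have := close ord_max u 0 x0; rewrite normr0; apply.
rewrite -[X in `|X|](subrKA (\sum_(l < 4) iter l (pd_x 1) F (pt u 0) / l`!%:R * v ^+ l)).
apply: le_trans (ler_normD _ _) _.
rewrite -sumrB.
have sums : `|\sum_(l < 4) (iter l (pd_x 1) F (pt u 0) / l`!%:R * v ^+ l -
   (\sum_(k < (3 - l).+1) a k l / k`!%:R * u ^+ k) / l`!%:R * v ^+ l)| <=
   \sum_(l < 4) e * `|x| ^+ 3.
  apply: le_trans (ler_norm_sum _ _ _) _; apply: ler_sum => l _.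
  rewrite -!mulrA -mulrBl normrM.
  have l3 : (l <= 3)%N by rewrite -ltnS.
  apply: le_trans (ler_pM (normr_ge0 _) (normr_ge0 _) (rows l) (lexx _)) _.
  rewrite -mulrA; apply: ler_wpM2l; first exact: ltW.
  rewrite -[in leRHS](subnK l3) exprD.
  apply: ler_pM => //; first by rewrite lerXn2r ?nnegrE.
  rewrite normrM normrX normfV -[leRHS]mul1r ler_pM// ?lerXn2r ?nnegrE//.
  rewrite normr_nat invf_le1 ?ler1n ?ltr0n fact_gt0//.
have col' : (e + e) * `|v| ^+ 3 <= (e + e) * `|x| ^+ 3.
  apply: ler_wpM2l; first by rewrite addr_ge0// ltW.
  by rewrite lerXn2r ?nnegrE.
apply: le_trans (lerD (le_trans col col') sums) _.
rewrite sumr_const card_ord -mulr_natr.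
have x3 : 0 <= `|x| ^+ 3 by rewrite exprn_ge0.
nra.
Qed.

Hypothesis F_odd : forall x mu, F (- x, mu) = - F (x, mu).

(** The quadratic part of the third Taylor polynomial of an odd function drops out
    by antisymmetrisation. *)
Lemma taylor_plane_odd (delta : R) : 0 < delta -> \forall x \near (0 : V),
  `|F (x, 0) - (a 1 0 * x 0 0 + a 0 1 * x 0 1 + a 3 0 / 6 * x 0 0 ^+ 3
      + a 2 1 / 2 * x 0 0 ^+ 2 * x 0 1 + a 1 2 / 2 * x 0 0 * x 0 1 ^+ 2
      + a 0 3 / 6 * x 0 1 ^+ 3)| <= delta * `|x| ^+ 3.
Proof.
move=> d0; have T := taylor_plane d0.
have TN : \forall x \near (0 : V),
    `|F (- x, 0) - taylor3 a (- x 0 0) (- x 0 1)| <= delta * `|x| ^+ 3.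
  move: T => /nbhs_ballP[r r0 rP]; apply/nbhs_ballP; exists r => // x xr.
  have : ball 0 r (- x) by move: xr; rewrite -!ball_normE/= !sub0r !normrN.
  by move=> /rP /=; rewrite normrN !mxE.
near=> x.
have Tx : `|F (x, 0) - taylor3 a (x 0 0) (x 0 1)| <= delta * `|x| ^+ 3 by near: x.
have TNx : `|F (- x, 0) - taylor3 a (- x 0 0) (- x 0 1)| <= delta * `|x| ^+ 3 by near: x.
move: TNx; rewrite F_odd => TNx.
set u := x 0 0 in Tx TNx *; set v := x 0 1 in Tx TNx *.
rewrite -taylor3_odd_part.
move: Tx TNx; set P := taylor3 a u v; set N := taylor3 a (- u) (- v); set D := delta * _.
rewrite !ler_norml => /andP[h1 h2] /andP[h3 h4].
by apply/andP; split; lra.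
Unshelve. all: by end_near. Qed.

End Expansion.

Section Mixed.
Variable R : realType.
Local Notation V := 'rV[R]_2.

Lemma row2_axes (x : V) : x = x 0 0 *: delta_mx 0 0 + x 0 1 *: delta_mx 0 1.
Proof. by have [] := ptE x. Qed.

Lemma dotB2 (u v p q p' q' : R) :
  u * p + v * q - (u * p' + v * q') = u * (p - p') + v * (q - q').
Proof. by ring. Qed.

Lemma norm_dot2 (u v p q B P : R) : `|u| <= B -> `|v| <= B -> `|p| <= P ->
  `|q| <= P -> `|u * p + v * q| <= 2 * P * B.
Proof.
move=> uB vB pP qP; apply: le_trans (ler_normD _ _) _; rewrite !normrM.
have := ler_pM (normr_ge0 u) (normr_ge0 p) uB pP.
have := ler_pM (normr_ge0 v) (normr_ge0 q) vB qP.
lra.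
Qed.

Lemma derive_x_sum (G : V * V -> R) p (x : V) : differentiable G p ->
  'D_(x, 0) G p = x 0 0 * pd_x 0 G p + x 0 1 * pd_x 1 G p.
Proof.
move=> dG; rewrite /pd_x !deriveE//.
have -> : (x, 0) = x 0 0 *: (delta_mx 0 0, 0) + x 0 1 *: (delta_mx 0 1, 0) :> V * V.
  rewrite -[RHS]/(_ *: _ + _ *: _, _ *: 0 + _ *: 0) !scaler0 addr0.
  by congr pair; exact: row2_axes.
by rewrite linearD !linearZ.
Qed.

Lemma derive_mu_sum (G : V * V -> R) p (mu : V) : differentiable G p ->
  'D_(0, mu) G p = mu 0 0 * pd_mu 0 G p + mu 0 1 * pd_mu 1 G p.
Proof.
move=> dG; rewrite /pd_mu !deriveE//.
have -> : (0, mu) = mu 0 0 *: (0, delta_mx 0 0) + mu 0 1 *: (0, delta_mx 0 1) :> V * V.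
  rewrite -[RHS]/(_ *: 0 + _ *: 0, _ *: _ + _ *: _) !scaler0 addr0.
  by congr pair; exact: row2_axes.
by rewrite linearD !linearZ.
Qed.

Variable F : V * V -> R.
Hypotheses (F_C2 : Cclass 2 F) (F_0 : forall mu, F (0, mu) = 0).

Let b k l := pd_x k (pd_mu l F) 0.

(** Dependence on the parameters, to first order in [x] and in [mu]: the mean value
    inequality along [mu], then along [x]. *)
Lemma mixed_expansion (delta : R) : 0 < delta -> exists2 r, 0 < r &
  forall x mu : V, `|x| < r -> `|mu| < r ->
  `|F (x, mu) - F (x, 0) - (mu 0 0 * (x 0 0 * b 0 0 + x 0 1 * b 1 0)
     + mu 0 1 * (x 0 0 * b 0 1 + x 0 1 * b 1 1))| <= delta * (`|x| * `|mu|).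
Proof.
move=> d0; have [e e0 ->] : exists2 e, 0 < e & delta = 4 * e.
  by exists (delta / 4); [rewrite divr_gt0|field].
have [dF DF] := F_C2.
have G_C1 l : Cclass 1 (pd_mu l F) by exact: DF.
(* [F] vanishes identically on [x = 0], hence so does its derivative along [mu]. *)
have G_0 l mu : pd_mu l F (0, mu) = 0.
  have := is_derive_curve_comp (c := fun s : R => (0, mu) + s *: ((0, delta_mx 0 l) : V * V))
    (t := 0) (dF ((0, mu) + 0 *: ((0, delta_mx 0 l) : V * V)) I) (is_derive_line _ _ _).
  rewrite (_ : (fun s : R => _) = cst 0); last first.
    apply/funext => s; rewrite -[X in F X]/(0 + s *: 0, mu + s *: delta_mx 0 l).
    by rewrite scaler0 addr0 F_0.
  by rewrite scale0r addr0 => /@derive_val; rewrite derive_cst /pd_mu => <-.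
have Ac (kl : 'I_2 * 'I_2) : {for 0, continuous (pd_x kl.1 (pd_mu kl.2 F))}.
  by have [_ /(_ (delta_mx 0 kl.1, 0) 0 I)] := G_C1 kl.2.
have : \forall p \near (0 : V * V), forall kl : 'I_2 * 'I_2,
    `|pd_x kl.1 (pd_mu kl.2 F) p - b kl.1 kl.2| <= e.
  apply: (@filter_forall (V * V)%type ('I_2 * 'I_2)%type (fun kl p =>
    `|pd_x kl.1 (pd_mu kl.2 F) p - b kl.1 kl.2| <= e) _ (nbhs_filter _)) => kl.
  have /cvgrPdist_le/(_ _ e0) := Ac kl.
  by apply: filterS => p hp; rewrite distrC /b; exact: hp.
move=> /nbhs_ballP[r r0 rP].
have {rP} close k l (x mu : V) : `|x| < r -> `|mu| < r ->
    `|pd_x k (pd_mu l F) (x, mu) - b k l| <= e.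
  move=> xr mr; apply: (rP (x, mu) _ (k, l)); rewrite -ball_normE/= sub0r normrN.
  by rewrite prod_normE/= gt_max xr.
exists r => // x mu xr mr.
have x0 := norm_coord_le x 0; have x1 := norm_coord_le x 1.
have m0 := norm_coord_le mu 0; have m1 := norm_coord_le mu 1.
have sr (s : R) (y : V) : `|y| < r -> `|s| <= 1 -> `|s *: y| < r.
  move=> yr s1; apply: le_lt_trans yr; rewrite normrZ ler_piMl//.
have Gb l (nu : V) : `|nu| < r ->
    `|pd_mu l F (x, nu) - (x 0 0 * b 0 l + x 0 1 * b 1 l)| <= 2 * e * `|x|.
  move=> nr.
  have := @mean_value_bound R (fun s => pd_mu l F ((0, nu) + s *: (x, 0)))
    (fun s => 'D_(x, 0) (pd_mu l F) ((0, nu) + s *: (x, 0)))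
    (x 0 0 * b 0 l + x 0 1 * b 1 l) (2 * e * `|x|) 1.
  have E (s : R) : (0, nu) + s *: (x, 0) = (s *: x, nu) :> V * V.
    by rewrite -[LHS]/(0 + s *: x, nu + s *: 0) scaler0 addr0 add0r.
  rewrite !E scale0r scale1r G_0 subr0 normr1 !mulr1; apply => s s1.
    exact: is_derive_curve_comp (Cclass_differentiable _ (G_C1 l)) (is_derive_line _ _ _).
  rewrite derive_x_sum; last exact: Cclass_differentiable (G_C1 l).
  rewrite E dotB2.
  by apply: norm_dot2 => //; apply: close => //; exact: sr.
have := @mean_value_bound R (fun s => F ((x, 0) + s *: (0, mu)))
    (fun s => 'D_(0, mu) F ((x, 0) + s *: (0, mu)))
    (mu 0 0 * (x 0 0 * b 0 0 + x 0 1 * b 1 0)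
     + mu 0 1 * (x 0 0 * b 0 1 + x 0 1 * b 1 1)) (4 * e * (`|x| * `|mu|)) 1.
have E (s : R) : (x, 0) + s *: (0, mu) = (x, s *: mu) :> V * V.
  by rewrite -[LHS]/(x + s *: 0, 0 + s *: mu) scaler0 addr0 add0r.
rewrite !E scale0r scale1r normr1 !mulr1; apply => s s1.
  exact: is_derive_curve_comp (dF _ I) (is_derive_line _ _ _).
rewrite derive_mu_sum; last exact: dF.
rewrite E dotB2.
have smr := sr _ _ mr s1.
have := norm_dot2 m0 m1 (Gb 0 _ smr) (Gb 1 _ smr).
by rewrite (_ : 2 * (2 * e * `|x|) * `|mu| = 4 * e * (`|x| * `|mu|)); last by ring.
Qed.

End Mixed.

Section FieldExpansion.
Variable R : realType.
Local Notation V := 'rV[R]_2.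
Variable f : V * V -> V.
Hypotheses (f_C4 : Cclass 4 f) (f_odd : forall x mu, f (- x, mu) = - f (x, mu))
  (f_lin : (jacobian (fun x => f (x, 0)) 0)^T = delta_mx 0 1).

(** The first-order dependence on the parameters of the entry [(j, k)] of the
    linear part. *)
Definition lin_mu (j k : 'I_2) (mu : V) : R :=
  coef_b f j k 0 * mu 0 0 + coef_b f j k 1 * mu 0 1.

(** The cubic part of the component [j] of the field. *)
Definition cubic (j : 'I_2) (u v : R) : R :=
  coef_a f j 3 0 / 6 * u ^+ 3 + coef_a f j 2 1 / 2 * u ^+ 2 * v
    + coef_a f j 1 2 / 2 * u * v ^+ 2 + coef_a f j 0 3 / 6 * v ^+ 3.

Lemma Cclass_component (j : 'I_2) : Cclass 4 (fun p => f p 0 j).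
Proof. exact: (Cclass_on_postlin openT (@coord_lin_continuous R 2 j) f_C4). Qed.

Lemma field_at0 (mu : V) : f (0, mu) = 0.
Proof.
have := f_odd 0 mu; rewrite oppr0 => /eqP.
by rewrite -subr_eq0 opprK -mulr2n -scaler_nat scaler_eq0 pnatr_eq0/= => /eqP.
Qed.

Lemma linear_coef (i j : 'I_2) :
  pd_x i (fun p => f p 0 j) 0 = (delta_mx 0 1 : 'M[R]_2) j i.
Proof.
have df := Cclass_differentiable (0 : V * V) f_C4.
rewrite -f_lin mxE /pd_x.
rewrite (derive_postlin (L := @coord R 2 j) _ (@coord_lin_continuous R 2 j) df) /coord.
have dinj (x : V) := linear_differentiable x (@inj1_continuous R V V).
have df0 : differentiable f (inj1 V (0 : V)) by exact: df.
have dc : differentiable (fun x : V => f (x, 0)) 0.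
  exact: (@differentiable_comp _ _ _ _ (@inj1 R V V) f 0 (dinj 0) df0).
have : 'D_(delta_mx 0 i) (fun x : V => f (x, 0)) 0 = 'D_(delta_mx 0 i, 0) f 0.
  rewrite (deriveE _ dc) (deriveE _ df).
  have := congr1 (fun h => h (delta_mx 0 i)) (diff_comp (dinj 0) df0).
  by rewrite /= (diff_lin _ (@inj1_continuous R V V)).
by move=> <-; rewrite deriveEjacobian// -rowE /= [LHS]mxE.
Qed.

Lemma combine_expansions (y y0 l u v m0 m1 b00 b10 b01 b11 p30 p21 p12 p03 : R) :
  y - (l * v + (b00 * m0 + b01 * m1) * u + (b10 * m0 + b11 * m1) * v
    + (p30 * u ^+ 3 + p21 * u ^+ 2 * v + p12 * u * v ^+ 2 + p03 * v ^+ 3)) =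
  y - y0 - (m0 * (u * b00 + v * b10) + m1 * (u * b01 + v * b11))
  + (y0 - (0 * u + l * v + p30 * u ^+ 3 + p21 * u ^+ 2 * v + p12 * u * v ^+ 2
      + p03 * v ^+ 3)).
Proof. by ring. Qed.

(** Expansion of the component [j] of the field, in which [(j == 0)%:R * x 0 1] is the
    nilpotent linear part. *)
Lemma field_expansion (j : 'I_2) (delta : R) : 0 < delta -> exists2 r, 0 < r &
  forall x mu : V, `|x| < r -> `|mu| < r ->
  `|f (x, mu) 0 j - ((j == 0)%:R * x 0 1 + lin_mu j 0 mu * x 0 0
      + lin_mu j 1 mu * x 0 1 + cubic j (x 0 0) (x 0 1))| <=
   delta * (`|x| ^+ 3 + `|mu| * `|x|).
Proof.
move=> d0; pose F p := f p 0 j.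
have F_C4 := Cclass_component j.
have F_odd x mu : F (- x, mu) = - F (x, mu) by rewrite /F f_odd mxE.
have F_0 mu : F (0, mu) = 0 by rewrite /F field_at0 mxE.
have [r1 r10 mix] := mixed_expansion (Cclass_le (isT : (2 <= 4)%N) F_C4) F_0 d0.
have /nbhs_ballP[r2 r20 tay] :=
  taylor_plane_odd (Cclass_le (isT : (3 <= 4)%N) F_C4) F_odd d0.
exists (Num.min r1 r2); first by rewrite lt_min r10.
move=> x mu; rewrite !lt_min => /andP[x1 x2] /andP[m1 _].
have {}mix := mix x mu x1 m1.
have {}tay := tay x _; move: tay; rewrite -ball_normE/= sub0r normrN => /(_ x2) tay.
move: tay; rewrite !linear_coef => tay.
move: mix tay; rewrite /F.
set A := (X in `|X| <= delta * (`|x| * _) -> _).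
set B := (X in _ -> `|X| <= delta * `|x| ^+ 3 -> _) => hA hB.
have -> : f (x, mu) 0 j - ((j == 0)%:R * x 0 1 + lin_mu j 0 mu * x 0 0
   + lin_mu j 1 mu * x 0 1 + cubic j (x 0 0) (x 0 1)) = A + B.
  rewrite /A /B /lin_mu /cubic /coef_b /coef_a !mxE (_ : (0 == 1 :> 'I_2) = false)//.
  rewrite eqxx andbT andbF -[(0, 0)]/(0 : V * V).
  exact: combine_expansions.
apply: le_trans (ler_normD _ _) _; rewrite mulrDr addrC [`|mu| * _]mulrC.
exact: lerD.
Qed.

End FieldExpansion.

(** * Asymptotic comparison along a filter *)

Section Landau.
Variables (R : realType) (T : Type) (F : filter_on T).
Implicit Types (N M h k l : T -> R).

(** [h = o(N)] and [h = O(N)] along [F]. *)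
Definition small N h := forall d, 0 < d -> \forall p \near F, `|h p| <= d * `|N p|.
Definition big N h := exists2 C, 0 < C & \forall p \near F, `|h p| <= C * `|N p|.

Lemma small_big N h : small N h -> big N h.
Proof. by move=> sh; exists 1 => //; exact: sh. Qed.

Lemma small_ext N h k : (forall p, h p = k p) -> small N h -> small N k.
Proof. by move=> hk sh d d0; apply: filterS (sh d d0) => p; rewrite hk. Qed.

Lemma big_ext N h k : (forall p, h p = k p) -> big N h -> big N k.
Proof. by move=> hk [C C0 bh]; exists C => //; apply: filterS bh => p; rewrite hk. Qed.

Lemma smallD N h k : small N h -> small N k -> small N (fun p => h p + k p).
Proof.
move=> sh sk d d0; have d2 : 0 < d / 2 by rewrite divr_gt0.
apply: filterS2 (sh _ d2) (sk _ d2) => p hp kp.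
by apply: le_trans (ler_normD _ _) _; lra.
Qed.

Lemma smallN N h : small N h -> small N (fun p => - h p).
Proof. by move=> sh d d0; apply: filterS (sh d d0) => p; rewrite normrN. Qed.

Lemma smallB N h k : small N h -> small N k -> small N (fun p => h p - k p).
Proof. by move=> sh sk; apply: smallD => //; exact: smallN. Qed.

Lemma bigD N h k : big N h -> big N k -> big N (fun p => h p + k p).
Proof.
move=> [C C0 bh] [D D0 bk]; exists (C + D); first exact: addr_gt0.
apply: filterS2 bh bk => p hp kp.
by apply: le_trans (ler_normD _ _) _; lra.
Qed.

Lemma bigN N h : big N h -> big N (fun p => - h p).
Proof. by move=> [C C0 bh]; exists C => //; apply: filterS bh => p; rewrite normrN. Qed.

Lemma bigB N h k : big N h -> big N k -> big N (fun p => h p - k p).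
Proof. by move=> bh bk; apply: bigD => //; exact: bigN. Qed.

Lemma bigM N M h k : big N h -> big M k ->
  big (fun p => N p * M p) (fun p => h p * k p).
Proof.
move=> [C C0 bh] [D D0 bk]; exists (C * D); first exact: mulr_gt0.
apply: filterS2 bh bk => p hp kp; rewrite !normrM.
by rewrite mulrACA; exact: ler_pM.
Qed.

Lemma smallM N M h k : small N h -> big M k ->
  small (fun p => N p * M p) (fun p => h p * k p).
Proof.
move=> sh [D D0 bk] d d0; have dD : 0 < d / D by rewrite divr_gt0.
apply: filterS2 (sh _ dD) bk => p hp kp; rewrite !normrM.
have -> : d = d / D * D by field; exact: lt0r_neq0.
by rewrite mulrACA; exact: ler_pM.
Qed.

Lemma big_trans N M h : big N h -> big M N -> big M h.
Proof.
move=> [C C0 bh] [D D0 bk]; exists (C * D); first exact: mulr_gt0.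
apply: filterS2 bh bk => p hp kp; apply: le_trans hp _.
by rewrite -mulrA ler_pM2l.
Qed.

Lemma small_trans N M h : small N h -> big M N -> small M h.
Proof.
move=> sh [D D0 bk] d d0; have dD : 0 < d / D by rewrite divr_gt0.
apply: filterS2 (sh _ dD) bk => p hp kp; apply: le_trans hp _.
have -> : d * `|M p| = d / D * (D * `|M p|) by field; exact: lt0r_neq0.
by rewrite ler_pM2l.
Qed.

Lemma big_small N M h : big N h -> small M N -> small M h.
Proof.
move=> [C C0 bh] sN d d0; have dC : 0 < d / C by rewrite divr_gt0.
apply: filterS2 bh (sN _ dC) => p hp Np; apply: le_trans hp _.
by rewrite mulrC -ler_pdivlMr// mulrAC.
Qed.

Lemma big_refl N : big N N.
Proof. by exists 1 => //; apply: nearW => p; rewrite mul1r. Qed.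

Lemma big_le N h : (forall p, `|h p| <= `|N p|) -> big N h.
Proof. by move=> hN; exists 1 => //; apply: nearW => p; rewrite mul1r. Qed.

Lemma big_cst c : big (fun=> 1) (fun=> c).
Proof.
exists (`|c| + 1); first by rewrite ltr_wpDl.
by apply: nearW => p; rewrite normr1 mulr1 lerDl.
Qed.

Lemma small0 N : small N (fun=> 0).
Proof. by move=> d d0; apply: nearW => p; rewrite normr0 mulr_ge0// ltW. Qed.

Local Notation bounded := (big (fun=> 1)).
Local Notation vanishes := (small (fun=> 1)).

Lemma bigMl N h k : bounded h -> big N k -> big N (fun p => h p * k p).
Proof.
by move=> bh bk; have := bigM bh bk; move/big_trans; apply; apply: big_le => p; rewrite mul1r.
Qed.

Lemma bigMr N h k : big N h -> bounded k -> big N (fun p => h p * k p).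
Proof. by move=> bh bk; apply: big_ext (bigMl bk bh) => p; rewrite mulrC. Qed.

Lemma bigZ N c h : big N h -> big N (fun p => c * h p).
Proof. by apply: bigMl; exact: big_cst. Qed.

Lemma smallMl N h k : small N h -> bounded k -> small N (fun p => h p * k p).
Proof.
by move=> sh bk; have := smallM sh bk; move/small_trans; apply; apply: big_le => p; rewrite mulr1.
Qed.

Lemma smallMr N h k : bounded h -> small N k -> small N (fun p => h p * k p).
Proof. by move=> bh sk; apply: small_ext (smallMl sk bh) => p; rewrite mulrC. Qed.

(** [o(1) O(N) = o(N)] *)
Lemma vanishesM N h k : vanishes h -> big N k -> small N (fun p => h p * k p).
Proof.
by move=> sh bk; have := smallM sh bk; move/small_trans; apply; apply: big_le => p; rewrite mul1r.
Qed.

Lemma bigM_vanishes N h k : big N h -> vanishes k -> small N (fun p => h p * k p).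
Proof. by move=> bh sk; apply: small_ext (vanishesM sk bh) => p; rewrite mulrC. Qed.

Lemma smallZ N c h : small N h -> small N (fun p => c * h p).
Proof. by apply: smallMr; exact: big_cst. Qed.

Lemma vanishes_near h d : vanishes h -> 0 < d -> \forall p \near F, `|h p| <= d.
Proof. by move=> sh d0; apply: filterS (sh d d0) => p; rewrite normr1 mulr1. Qed.

Lemma bounded_vanishesD c h : vanishes (fun p => h p - c) -> bounded h.
Proof.
move=> /small_big sh; apply: big_ext (bigD sh (big_cst c)) => p.
by rewrite subrK.
Qed.

(** A function tending to 1 is eventually at least 1/2. *)
Lemma near1_pos h : vanishes (fun p => h p - 1) -> \forall p \near F, 1 / 2 <= h p.
Proof.
have d0 : (0 : R) < 1 / 2 by lra.
move=> /vanishes_near/(_ d0); apply: filterS => p; rewrite ler_norml => /andP[]; lra.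
Qed.

Lemma near1_inv h : vanishes (fun p => h p - 1) -> bounded (fun p => (h p)^-1).
Proof.
move=> h1; exists 2 => //; apply: filterS (near1_pos h1) => p hp.
rewrite normr1 mulr1 ger0_norm; last by rewrite invr_ge0; lra.
have -> : 2 = (1 / 2)^-1 :> R by field.
by rewrite lef_pV2 ?posrE//; lra.
Qed.

Variable N : T -> R.
Hypothesis N0 : vanishes N.

(** [h = 1 + l + o(N)] with [l = O(N)]. *)
Definition jet l h := big N l /\ small N (fun p => h p - 1 - l p).

Lemma bigN_vanishes h : big N h -> vanishes h.
Proof. by move=> bh; exact: big_small bh N0. Qed.

Lemma jet_big l h : jet l h -> big N (fun p => h p - 1).
Proof.
move=> [bl sh]; apply: big_ext (bigD (small_big sh) bl) => p.
by rewrite subrK.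
Qed.

Lemma jet_vanishes l h : jet l h -> vanishes (fun p => h p - 1).
Proof. by move=> /jet_big; exact: bigN_vanishes. Qed.

Lemma jet_bounded l h : jet l h -> bounded h.
Proof. by move=> /jet_vanishes; exact: bounded_vanishesD. Qed.

Lemma jet_congr l l' h : jet l h -> small N (fun p => l p - l' p) -> jet l' h.
Proof.
move=> [bl sh] sl; split.
  by apply: big_ext (bigB bl (small_big sl)) => p; rewrite subKr.
by apply: small_ext (smallD sh sl) => p; ring.
Qed.

Lemma jet_eq l l' h h' : jet l h -> (forall p, l p = l' p) -> (forall p, h p = h' p) ->
  jet l' h'.
Proof.
move=> [bl sh] ll hh; split; first exact: big_ext bl.
by apply: small_ext sh => p; rewrite ll hh.
Qed.

(** Jets multiply, the product of the parts [l], [l'] being negligible. *)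
Lemma jetM l l' h h' : jet l h -> jet l' h' ->
  jet (fun p => l p + l' p) (fun p => h p * h' p).
Proof.
move=> jh jh'; have [bl sh] := jh; have [bl' sh'] := jh'.
split; first exact: bigD.
have s1 := vanishesM (jet_vanishes jh) (jet_big jh').
apply: small_ext (smallD s1 (smallD sh sh')) => p.
by ring.
Qed.

Lemma jet_affine l : big N l -> jet l (fun p => 1 + l p).
Proof.
by move=> bl; split => //; apply: small_ext (small0 N) => p; ring.
Qed.

Lemma big_sqr_small h : big N h -> small N (fun p => h p * h p).
Proof. by move=> bh; apply: vanishesM => //; exact: bigN_vanishes. Qed.

Lemma small_near_le h k : small N h ->
  (\forall p \near F, `|k p| <= 2 * `|h p|) -> small N k.
Proof.
move=> sh kh d d0; have d2 : 0 < d / 2 by rewrite divr_gt0.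
by apply: filterS2 (sh _ d2) kh => p; lra.
Qed.

Lemma jet_inv h : big N h -> jet h (fun p => (1 - h p)^-1).
Proof.
move=> bh; split => //; apply: small_near_le (big_sqr_small bh) _.
have d0 : (0 : R) < 1 / 2 by lra.
apply: filterS (vanishes_near (bigN_vanishes bh) d0) => p; set t := h p => ht.
have /andP[h1 h2] : - (1 / 2) <= t <= 1 / 2 by rewrite -ler_norml.
have t1 : 0 < 1 - t by lra.
have -> : (1 - t)^-1 - 1 - t = t * t * (1 - t)^-1 by field; lra.
rewrite normrM mulrC ler_wpM2r// ger0_norm; last by rewrite invr_ge0 ltW.
have -> : 2 = (1 / 2)^-1 :> R by field.
by rewrite lef_pV2 ?posrE//; lra.
Qed.

Lemma jet_invsqrt h : big N h -> jet (fun p => h p / 2) (fun p => (Num.sqrt (1 - h p))^-1).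
Proof.
move=> bh; split; first by apply: bigMr => //; exact: big_cst.
apply: small_near_le (big_sqr_small bh) _.
have d0 : (0 : R) < 1 / 2 by lra.
apply: filterS (vanishes_near (bigN_vanishes bh) d0) => p; set t := h p => ht.
have /andP[h1 h2] : - (1 / 2) <= t <= 1 / 2 by rewrite -ler_norml.
have t1 : 0 < 1 - t by lra.
have s0 : 0 < Num.sqrt (1 - t) by rewrite sqrtr_gt0.
have wt : (Num.sqrt (1 - t))^-1 ^+ 2 * (1 - t) = 1.
  by rewrite -{2}(sqr_sqrtr (ltW t1)) exprVn mulVf// sqrf_eq0 gt_eqF.
have w0 : 0 < (Num.sqrt (1 - t))^-1 by rewrite invr_gt0.
move: wt w0; set w := _^-1 => wt w0 {s0}.
have w1 : (w - 1) = t * w ^+ 2 / (w + 1).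
  by apply: (mulIf (x := w + 1)); [lra|rewrite divfK; [nra|lra]].
have -> : w - 1 - t / 2 = t * t * (w ^+ 2 / (w + 1) * ((2 * w + 1) / (2 * (w + 1)))).
  transitivity (t * ((w - 1) * ((2 * w + 1) / (2 * (w + 1))))).
    have -> : w - 1 - t / 2 = t * w ^+ 2 / (w + 1) - t / 2 by rewrite -w1.
    by field; lra.
  by rewrite w1; field; lra.
rewrite normrM mulrC ler_wpM2r//.
have w2 : w ^+ 2 <= 2 by nra.
have a1 : 0 <= w ^+ 2 / (w + 1) <= 2.
  apply/andP; split; first by rewrite divr_ge0 ?sqr_ge0//; lra.
  by rewrite ler_pdivrMr; lra.
have a2 : 0 <= (2 * w + 1) / (2 * (w + 1)) <= 1.
  apply/andP; split; first by rewrite divr_ge0//; lra.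
  by rewrite ler_pdivrMr; lra.
move: a1 a2 => /andP[a1 b1] /andP[a2 b2].
rewrite ger0_norm ?mulr_ge0//; nra.
Qed.

End Landau.

(** * An explicitly invertible change of coordinates *)

Section ExplicitChange.
Variables (R : realType) (al be e A B P : R).

(** The new coordinates. Here [m0], [m1] stand for coefficients that vanish with
    [mu], and [z] for a term that vanishes with [eps]. Given [v], the map
    [u * scale1 u |-> new1 u v] is fractional linear; given [new1 u v], so is
    [v |-> new2 u v m0 m1 z]. *)
Definition scale1 (u : R) : R := (Num.sqrt (1 - 2 * al * u ^+ 2))^-1.

Definition den1 (u v : R) : R := 1 - be * (u * scale1 u) * v.

Definition new1 (u v : R) : R :=
  u * (scale1 u * (1 + e * v ^+ 2) * (den1 u v)^-1).

Definition den2 (u v : R) : R := 1 - B * new1 u v * v.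

Definition num2 (u v m1 : R) : R := 1 + (A * new1 u v ^+ 2 + m1).

Definition new2 (u v m0 m1 z : R) : R :=
  v * (num2 u v m1 * (den2 u v)^-1) + m0 * new1 u v + P * new1 u v ^+ 3 + z.

(** The inverse change: [old2] recovers [v], then [old_s] recovers [u * scale1 u],
    and [old1] recovers [u]. *)
Definition old_z (y1 y2 m0 z : R) : R := y2 - m0 * y1 - P * y1 ^+ 3 - z.

Definition iden2 (y1 y2 m0 m1 z : R) : R :=
  1 + A * y1 ^+ 2 + m1 + B * y1 * old_z y1 y2 m0 z.

Definition old2 (y1 y2 m0 m1 z : R) : R :=
  old_z y1 y2 m0 z * (iden2 y1 y2 m0 m1 z)^-1.

Definition iden1 (y1 v : R) : R := 1 + e * v ^+ 2 + be * y1 * v.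

Definition old_s (y1 v : R) : R := y1 * (iden1 y1 v)^-1.

Definition old1 (s : R) : R := s * (Num.sqrt (1 + 2 * al * s ^+ 2))^-1.

(** Conditions [dom_new], [dom_old] under which the change, resp. its inverse, is defined
    and is undone by the other one. *)
Definition dom_new (u v m1 : R) : Prop :=
  [/\ 0 < 1 - 2 * al * u ^+ 2, den1 u v != 0, 1 + e * v ^+ 2 != 0,
      den2 u v != 0 & num2 u v m1 != 0].

Definition dom_old (y1 y2 m0 m1 z : R) : Prop :=
  let v := old2 y1 y2 m0 m1 z in
  [/\ iden2 y1 y2 m0 m1 z != 0, 1 + A * y1 ^+ 2 + m1 != 0, 1 + e * v ^+ 2 != 0,
      iden1 y1 v != 0 & 0 < 1 + 2 * al * old_s y1 v ^+ 2].

Lemma scale1_sqr u : 0 < 1 - 2 * al * u ^+ 2 ->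
  0 < scale1 u /\ (1 - 2 * al * u ^+ 2) * scale1 u ^+ 2 = 1.
Proof.
move=> h; rewrite /scale1 invr_gt0 sqrtr_gt0; split => //.
by rewrite exprVn sqr_sqrtr ?ltW// mulfV// gt_eqF.
Qed.

Lemma new_oldK u v m0 m1 z : dom_new u v m1 ->
  let y1 := new1 u v in let y2 := new2 u v m0 m1 z in
  [/\ dom_old y1 y2 m0 m1 z, old2 y1 y2 m0 m1 z = v & old1 (old_s y1 v) = u].
Proof.
move=> [h1 h2 h3 h4 h5] y1 y2.
have zE : old_z y1 y2 m0 z = v * num2 u v m1 / den2 u v.
  by rewrite /old_z /y2 /new2 -/y1; ring.
have d2E : iden2 y1 y2 m0 m1 z = num2 u v m1 / den2 u v.
  rewrite /iden2 zE.
  have -> : 1 + A * y1 ^+ 2 + m1 = num2 u v m1 by rewrite /num2 -/y1; ring.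
  have -> : B * y1 * (v * num2 u v m1 / den2 u v) =
    (1 - den2 u v) * (num2 u v m1 / den2 u v) by rewrite /den2 -/y1; ring.
  by field.
have vE : old2 y1 y2 m0 m1 z = v by rewrite /old2 zE d2E; field; rewrite h4.
have d1E : iden1 y1 v = (1 + e * v ^+ 2) / den1 u v.
  rewrite /iden1 /y1 /new1.
  have -> : be * (u * (scale1 u * (1 + e * v ^+ 2) / den1 u v)) * v =
    (1 - den1 u v) * ((1 + e * v ^+ 2) / den1 u v) by rewrite /den1; ring.
  by field.
have sE : old_s y1 v = u * scale1 u.
  by rewrite /old_s d1E /y1 /new1; field; rewrite h2 h3.
have [w0 wE] := scale1_sqr h1.
have rE : 1 + 2 * al * (u * scale1 u) ^+ 2 = scale1 u ^+ 2.
  have -> : scale1 u ^+ 2 = (1 - 2 * al * u ^+ 2) * scale1 u ^+ 2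
    + 2 * al * (u * scale1 u) ^+ 2 by ring.
  by rewrite wE.
have w20 : 0 < scale1 u ^+ 2 by rewrite exprn_gt0.
split=> //; last first.
  by rewrite sE /old1 rE sqrtr_sqr ger0_norm ?(ltW w0)// mulfK// gt_eqF.
rewrite /dom_old vE d2E d1E sE rE; split => //.
- by rewrite mulf_neq0// invr_neq0.
- by move: h5; rewrite /num2 addrA.
- by rewrite mulf_neq0// invr_neq0.
Qed.

Lemma old_newK y1 y2 m0 m1 z : dom_old y1 y2 m0 m1 z ->
  let v := old2 y1 y2 m0 m1 z in let u := old1 (old_s y1 v) in
  new1 u v = y1 /\ new2 u v m0 m1 z = y2.
Proof.
move=> [h1 h2]; set v := old2 _ _ _ _ _ => h3 h4 h5; rewrite /=; set u := old1 _.
have vE : v = old2 y1 y2 m0 m1 z by [].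
clearbody v.
have sE : old_s y1 v = y1 / iden1 y1 v by [].
move: @u h5; move: (old_s y1 v) sE => s sE u h5.
have q0 : 0 < Num.sqrt (1 + 2 * al * s ^+ 2) by rewrite sqrtr_gt0.
have qE := sqr_sqrtr (ltW h5).
have rE : 1 - 2 * al * u ^+ 2 = (Num.sqrt (1 + 2 * al * s ^+ 2))^-1 ^+ 2.
  rewrite /u /old1 exprMn exprVn qE.
  by field; rewrite gt_eqF.
have wE : scale1 u = Num.sqrt (1 + 2 * al * s ^+ 2).
  by rewrite /scale1 rE sqrtr_sqr ger0_norm ?invr_ge0 ?(ltW q0)// invrK.
have uwE : u * scale1 u = s by rewrite wE /u /old1 divfK// gt_eqF.
have d1E : den1 u v = (1 + e * v ^+ 2) / iden1 y1 v.
  by rewrite /den1 uwE sE; move: h4; rewrite /iden1 => h4; field.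
have y1E : new1 u v = y1.
  by rewrite /new1 !mulrA uwE d1E sE; field; rewrite h3 h4.
split=> //.
have d2E : den2 u v = (1 + A * y1 ^+ 2 + m1) / iden2 y1 y2 m0 m1 z.
  by rewrite /den2 y1E vE /old2; move: h1; rewrite /iden2 => h1; field.
rewrite /new2 d2E /num2 y1E addrA.
have -> : v * ((1 + A * y1 ^+ 2 + m1) *
    ((1 + A * y1 ^+ 2 + m1) / iden2 y1 y2 m0 m1 z)^-1) =
   old_z y1 y2 m0 z.
  by rewrite vE /old2; field; rewrite h1 h2.
by rewrite /old_z; ring.
Qed.

End ExplicitChange.

Section DeriveChange.
Variables (R : realType) (W : normedModType R) (q dir : W).

(** Pointwise forms of the rules of derivation. *)
Lemma is_deriveMp (f g : W -> R) (df dg : R) :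
  is_derive q dir f df -> is_derive q dir g dg ->
  is_derive q dir (fun y => f y * g y) (f q * dg + g q * df).
Proof. by move=> hf hg; exact: is_deriveM. Qed.

Lemma is_deriveDp (f g : W -> R) (df dg : R) :
  is_derive q dir f df -> is_derive q dir g dg ->
  is_derive q dir (fun y => f y + g y) (df + dg).
Proof. by move=> hf hg; exact: is_deriveD. Qed.

Lemma is_deriveVp (f : W -> R) (df : R) : f q != 0 ->
  is_derive q dir f df -> is_derive q dir (fun y => (f y)^-1) (- (f q)^-1 ^+ 2 * df).
Proof.
move=> f0 [hf <-]; apply: DeriveDef; first exact: derivableV.
by rewrite deriveV// /GRing.scale/= exprVn.
Qed.

Lemma is_deriveC (c : R) : is_derive q dir (fun=> c) 0.
Proof. exact: is_derive_cst. Qed.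

Lemma is_derive_sqrtp (f : W -> R) (df : R) : 0 < f q -> differentiable f q ->
  is_derive q dir f df ->
  is_derive q dir (fun y => Num.sqrt (f y)) ((2 * Num.sqrt (f q))^-1 * df).
Proof.
move=> f0 hf [_ <-]; apply: DeriveDef; last exact: derive_sqrt_comp.
exact/diff_derivable/differentiable_sqrt_comp.
Qed.

Variables (al be e A B P : R).
Local Notation scale1 := (scale1 al).
Local Notation den1 := (den1 al be).
Local Notation new1 := (new1 al be e).
Local Notation den2 := (den2 al be e B).
Local Notation num2 := (num2 al be e A).
Local Notation new2 := (new2 al be e A B P).

(** Partial derivatives of the new coordinates: [d11], [d12] are those of [new1] in [u]
    and [v], and [d22] is that of [new2] in [v] when [new1] is kept fixed. *)
Definition d11 (u v : R) : R :=
  scale1 u ^+ 3 * (1 + e * v ^+ 2) * ((den1 u v)^-1 * (den1 u v)^-1).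

Definition d12 (u v : R) : R :=
  2 * e * (u * scale1 u) * v * (den1 u v)^-1
  + be * (u * scale1 u) ^+ 2 * (1 + e * v ^+ 2) * (den1 u v)^-1 ^+ 2.

Definition d22 (u v m1 : R) : R := num2 u v m1 * (den2 u v)^-1 ^+ 2.

(** Derivative of the second new coordinate with respect to the first one. *)
Definition d21 (u v m0 m1 : R) : R :=
  v * (2 * A * new1 u v) * (den2 u v)^-1
  + v ^+ 2 * B * num2 u v m1 * (den2 u v)^-1 ^+ 2 + m0 + 3 * P * new1 u v ^+ 2.

Variables (U V : W -> R) (dU dV : R).
Hypotheses (diffU : differentiable U q) (hU : is_derive q dir U dU)
  (hV : is_derive q dir V dV).

Lemma is_derive_new1 :
  0 < 1 - 2 * al * U q ^+ 2 -> den1 (U q) (V q) != 0 ->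
  is_derive q dir (fun y => new1 (U y) (V y))
    (d11 (U q) (V q) * dU + d12 (U q) (V q) * dV).
Proof.
move=> w0 D0.
have dw0 : differentiable (fun y => 1 - 2 * al * (U y * U y)) q.
  apply: differentiableB; first exact: differentiable_cst.
  apply: differentiableM; first exact: differentiable_cst.
  exact: differentiableM.
have hw : is_derive q dir (fun y => 1 - 2 * al * (U y * U y)) (- (2 * al * (2 * U q * dU))).
  have := is_deriveDp (is_deriveC 1) (is_deriveMp (is_deriveC (- (2 * al))) (is_deriveMp hU hU)).
  move=> h; rewrite (_ : (fun y => _) = (fun y => 1 + - (2 * al) * (U y * U y))).
    by apply: (is_derive_eq h); ring.
  by apply/funext => y; rewrite mulNr.
have s0 : 0 < Num.sqrt (1 - 2 * al * U q ^+ 2) by rewrite sqrtr_gt0.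
have hs := is_derive_sqrtp (f := fun y => 1 - 2 * al * (U y * U y)) w0 dw0 hw.
have hi := is_deriveVp (f := fun y => Num.sqrt (1 - 2 * al * (U y * U y)))
  (lt0r_neq0 s0) hs.
have {hi} hi : is_derive q dir (fun y => scale1 (U y)) (2 * al * U q * scale1 (U q) ^+ 3 * dU).
  apply: (is_derive_eq hi); rewrite /scale1.
  by rewrite -expr2; field; rewrite gt_eqF.
have hsU := is_deriveMp hU hi.
have E1 : U q * (2 * al * U q * scale1 (U q) ^+ 3 * dU) + scale1 (U q) * dU =
  scale1 (U q) ^+ 3 * dU.
  have [_ wE] := scale1_sqr w0.
  transitivity (scale1 (U q) * ((1 - 2 * al * U q ^+ 2) * scale1 (U q) ^+ 2) * dU
    + 2 * al * U q ^+ 2 * scale1 (U q) ^+ 3 * dU); last by ring.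
  by rewrite wE; ring.
have hD := is_deriveDp (is_deriveC 1) (is_deriveMp (is_deriveC (- be)) (is_deriveMp hsU hV)).
have hD' : is_derive q dir (fun y => den1 (U y) (V y))
    (- be * (scale1 (U q) ^+ 3 * dU * V q + U q * scale1 (U q) * dV)).
  rewrite (_ : (fun y => _) = (fun y => 1 + - be * (U y * scale1 (U y) * V y))); last first.
    by apply/funext => y; rewrite /den1; ring.
  by apply: (is_derive_eq hD); rewrite E1; ring.
have hV2 := is_deriveDp (is_deriveC 1) (is_deriveMp (is_deriveC e) (is_deriveMp hV hV)).
have hN := is_deriveMp (is_deriveMp hsU hV2) (is_deriveVp D0 hD').
rewrite (_ : (fun y => _) = (fun y => U y * scale1 (U y) * (1 + e * (V y * V y))
  * (den1 (U y) (V y))^-1)); last first.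
  by apply/funext => y; rewrite /new1; ring.
apply: (is_derive_eq hN).
rewrite E1 /d11 /d12.
have DE : be * (U q * scale1 (U q)) * V q = 1 - den1 (U q) (V q) by rewrite /den1; ring.
move: D0 DE; set D := den1 _ _ => D0 DE; set s := U q * scale1 (U q) in DE *.
have -> : scale1 (U q) ^+ 3 * (1 + e * V q ^+ 2) * (D^-1 * D^-1) * dU =
  scale1 (U q) ^+ 3 * (1 + e * V q ^+ 2) * dU * (D^-1 * (D + (be * s * V q)) * D^-1).
  by rewrite DE; field.
by field.
Qed.

Variables (Z M0 M1 : W -> R) (dZ : R).
Hypotheses (hZ : is_derive q dir Z dZ) (hM0 : is_derive q dir M0 0)
  (hM1 : is_derive q dir M1 0).

Lemma is_derive_new2 (dY : R) :
  is_derive q dir (fun y => new1 (U y) (V y)) dY ->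
  den2 (U q) (V q) != 0 ->
  is_derive q dir (fun y => new2 (U y) (V y) (M0 y) (M1 y) (Z y))
    (d22 (U q) (V q) (M1 q) * dV + dY * d21 (U q) (V q) (M0 q) (M1 q) + dZ).
Proof.
move=> hY D0; set Y := fun y => new1 (U y) (V y) in hY.
have hY2 := is_deriveMp hY hY.
have hD := is_deriveDp (is_deriveC 1) (is_deriveMp (is_deriveC (- B)) (is_deriveMp hY hV)).
have hD' : is_derive q dir (fun y => den2 (U y) (V y)) (- B * (dY * V q + Y q * dV)).
  rewrite (_ : (fun y => _) = (fun y => 1 + - B * (Y y * V y))); last first.
    by apply/funext => y; rewrite /den2 /Y; ring.
  by apply: (is_derive_eq hD); ring.
have hN := is_deriveDp (is_deriveC 1) (is_deriveDp (is_deriveMp (is_deriveC A) hY2) hM1).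
have hQ := is_deriveMp hV (is_deriveMp hN (is_deriveVp D0 hD')).
have h := is_deriveDp (is_deriveDp (is_deriveDp hQ (is_deriveMp hM0 hY))
  (is_deriveMp (is_deriveC P) (is_deriveMp hY hY2))) hZ.
rewrite (_ : (fun y => _) = (fun y =>
  V y * ((1 + (A * (Y y * Y y) + M1 y)) * (den2 (U y) (V y))^-1)
  + M0 y * Y y + P * (Y y * (Y y * Y y)) + Z y)); last first.
  by apply/funext => y; rewrite /new2 /num2 -/(Y y); ring.
apply: (is_derive_eq h).
rewrite /d22 /d21 -/(Y q) /num2 -/(Y q).
have DE : B * Y q * V q = 1 - den2 (U q) (V q) by rewrite /den2 /Y; ring.
move: D0 DE; set D := den2 _ _ => D0 DE.
have -> : (1 + (A * Y q ^+ 2 + M1 q)) * D^-1 ^+ 2 * dV =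
  (1 + (A * Y q ^+ 2 + M1 q)) * dV * (D^-1 * (D + B * Y q * V q) * D^-1).
  by rewrite DE; field.
by field.
Qed.

End DeriveChange.

Section CkChange.
Variables (R : realType) (W : normedModType R) (k : nat) (U : set W).
Hypothesis Uo : open U.
Variables (al be e A B P : R).
Local Notation Ck := (Cclass_on k U).

Lemma Cclass_onC (c : R) : Ck (fun=> c).
Proof. exact: Cclass_on_cst. Qed.

Lemma Cclass_onX (h : W -> R) n : Ck h -> Ck (fun q => h q ^+ n).
Proof.
move=> Ch; elim: n => [|n IH]; first by rewrite (_ : (fun q => _) = fun=> 1)//; exact: Cclass_onC.
rewrite (_ : (fun q => _) = fun q => h q * h q ^+ n); first exact: Cclass_onM.
by apply/funext => q; rewrite exprS.
Qed.

Lemma Cclass_onZ (c : R) (h : W -> R) : Ck h -> Ck (fun q => c * h q).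
Proof. by move=> Ch; apply: Cclass_onM => //; exact: Cclass_onC. Qed.

Lemma Cclass_onB (h h' : W -> R) : Ck h -> Ck h' -> Ck (fun q => h q - h' q).
Proof. by move=> Ch Ch'; apply: Cclass_onD => //; exact: Cclass_onN. Qed.

Lemma Cclass_on1D (h : W -> R) : Ck h -> Ck (fun q => 1 + h q).
Proof. by move=> Ch; apply: Cclass_onD => //; exact: Cclass_onC. Qed.

Lemma Cclass_on1B (h : W -> R) : Ck h -> Ck (fun q => 1 - h q).
Proof. by move=> Ch; apply: Cclass_onB => //; exact: Cclass_onC. Qed.

Variables (a b m0 m1 z : W -> R).
Hypotheses (Ca : Ck a) (Cb : Ck b) (Cm0 : Ck m0) (Cm1 : Ck m1) (Cz : Ck z).

Lemma Cclass_on_rsqrt (h : W -> R) : Ck h -> (forall q, U q -> 0 < h q) ->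
  Ck (fun q => (Num.sqrt (h q))^-1).
Proof.
move=> Ch h0; apply: Cclass_onV => // [q Uq|]; last exact: Cclass_on_sqrt.
by rewrite gt_eqF// sqrtr_gt0; exact: h0.
Qed.

Lemma Cclass_on_scale1 : (forall q, U q -> 0 < 1 - 2 * al * a q ^+ 2) ->
  Ck (fun q => scale1 al (a q)).
Proof.
move=> h0; apply: Cclass_on_rsqrt => //; apply: Cclass_on1B.
by apply: Cclass_onZ; exact: Cclass_onX.
Qed.

Lemma Cclass_on_new1 : (forall q, U q -> 0 < 1 - 2 * al * a q ^+ 2) ->
  (forall q, U q -> den1 al be (a q) (b q) != 0) ->
  Ck (fun q => new1 al be e (a q) (b q)).
Proof.
move=> h0 h1; have Cw := Cclass_on_scale1 h0.
apply: Cclass_onM => //; apply: Cclass_onM => //.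
  by apply: Cclass_onM => //; apply: Cclass_on1D; apply: Cclass_onZ; exact: Cclass_onX.
apply: Cclass_onV => //; apply: Cclass_on1B; apply: Cclass_onM => //.
by apply: Cclass_onZ; exact: Cclass_onM.
Qed.

Lemma Cclass_on_new2 : Ck (fun q => new1 al be e (a q) (b q)) ->
  (forall q, U q -> den2 al be e B (a q) (b q) != 0) ->
  Ck (fun q => new2 al be e A B P (a q) (b q) (m0 q) (m1 q) (z q)).
Proof.
move=> CY h0; apply: Cclass_onD => //; apply: Cclass_onD => //; last first.
  by apply: Cclass_onZ; exact: Cclass_onX.
apply: Cclass_onD => //; last exact: Cclass_onM.
apply: Cclass_onM => //; apply: Cclass_onM => //.
  by apply: Cclass_on1D; apply: Cclass_onD => //; apply: Cclass_onZ; exact: Cclass_onX.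
apply: Cclass_onV => //; apply: Cclass_on1B; apply: Cclass_onM => //.
exact: Cclass_onZ.
Qed.

Lemma Cclass_on_old_z : Ck (fun q => old_z P (a q) (b q) (m0 q) (z q)).
Proof.
apply: Cclass_onB => //; apply: Cclass_onB; last by apply: Cclass_onZ; exact: Cclass_onX.
by apply: Cclass_onB => //; exact: Cclass_onM.
Qed.

Lemma Cclass_on_iden2 : Ck (fun q => iden2 A B P (a q) (b q) (m0 q) (m1 q) (z q)).
Proof.
apply: Cclass_onD => //; last by apply: Cclass_onM; [by []|exact: Cclass_onZ|exact: Cclass_on_old_z].
by apply: Cclass_onD => //; apply: Cclass_on1D; apply: Cclass_onZ; exact: Cclass_onX.
Qed.

Lemma Cclass_on_old2 :
  (forall q, U q -> iden2 A B P (a q) (b q) (m0 q) (m1 q) (z q) != 0) ->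
  Ck (fun q => old2 A B P (a q) (b q) (m0 q) (m1 q) (z q)).
Proof.
move=> h0; apply: Cclass_onM => //; first exact: Cclass_on_old_z.
by apply: Cclass_onV => //; exact: Cclass_on_iden2.
Qed.

Lemma Cclass_on_iden1 : Ck (fun q => iden1 be e (a q) (b q)).
Proof.
apply: Cclass_onD => //; last by apply: Cclass_onM => //; exact: Cclass_onZ.
by apply: Cclass_on1D; apply: Cclass_onZ; exact: Cclass_onX.
Qed.

Lemma Cclass_on_old_s : (forall q, U q -> iden1 be e (a q) (b q) != 0) ->
  Ck (fun q => old_s be e (a q) (b q)).
Proof.
move=> h0; apply: Cclass_onM => //; apply: Cclass_onV => //.
exact: Cclass_on_iden1.
Qed.

Lemma Cclass_on_old1 : (forall q, U q -> 0 < 1 + 2 * al * a q ^+ 2) ->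
  Ck (fun q => old1 al (a q)).
Proof.
move=> h0; apply: Cclass_onM => //; apply: Cclass_on_rsqrt => //.
by apply: Cclass_on1D; apply: Cclass_onZ; exact: Cclass_onX.
Qed.

(** An open condition on a function of class C^k on an open set cuts out an open set. *)
Lemma open_Cclass_cond (h : W -> R) (O : set R) : Ck h -> open O ->
  open (U `&` h @^-1` O).
Proof.
move=> Ch Oo; rewrite openE => q [Uq Oq]; apply: filterI.
  exact: open_nbhs_nbhs.
have := Cclass_on_continuous Ch Uq; apply.
exact: open_nbhs_nbhs.
Qed.

End CkChange.

Lemma open_neq0 (R : realType) : open [set x : R | x != 0].
Proof.
rewrite (_ : [set x : R | x != 0] = ~` [set 0]); last first.
  by apply/seteqP; split => x /= /eqP.
by rewrite openC; exact: closed_eq.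
Qed.

Section ChangeOfVariables.
Variables (R : realType) (P : normedModType R).
Local Notation V := 'rV[R]_2.
Local Notation W := (V * P)%type.
Variables (al be e A B C l1 l2 : R) (m0 m1 z : P -> R) (k : nat).
Hypotheses (l10 : l1 != 0) (l20 : l2 != 0).
Hypotheses (Cm0 : Cclass k (fun q : W => m0 q.2)) (Cm1 : Cclass k (fun q : W => m1 q.2))
  (Cz : Cclass k (fun q : W => z q.2)).

(** The row vector of coordinates [a], [b]. *)
Definition row2 (a b : R) : V := \row_(i < 2) if i == 0 then a else b.

(** The change of coordinates with the scales [l1], [l2]; the coefficients
    [m0], [m1], [z] are functions of the parameters. *)
Definition change (q : W) : V :=
  row2 (l1 * new1 al be e (q.1 0 0) (q.1 0 1))
       (l2 * new2 al be e A B C (q.1 0 0) (q.1 0 1) (m0 q.2) (m1 q.2) (z q.2)).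

(** The inverse change, first componentwise and then fibred over the parameters. *)
Definition back2 (q : W) : R :=
  old2 A B C (q.1 0 0 / l1) (q.1 0 1 / l2) (m0 q.2) (m1 q.2) (z q.2).

Definition back1 (q : W) : R := old1 al (old_s be e (q.1 0 0 / l1) (back2 q)).

Definition unchange (q : W) : W := (row2 (back1 q) (back2 q), q.2).

Definition change_dom (q : W) : Prop :=
  dom_new al be e A B (q.1 0 0) (q.1 0 1) (m1 q.2).

Definition unchange_dom (q : W) : Prop :=
  dom_old al be e A B C (q.1 0 0 / l1) (q.1 0 1 / l2) (m0 q.2) (m1 q.2) (z q.2).

Lemma row2E0 a b : row2 a b 0 0 = a.
Proof. by rewrite mxE. Qed.

Lemma row2E1 a b : row2 a b 0 1 = b.
Proof. by rewrite mxE. Qed.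

Lemma row2_coord (x : V) : row2 (x 0 0) (x 0 1) = x.
Proof.
apply/rowP; case=> -[|[|//]] i; rewrite mxE/=; congr (x _ _); exact: val_inj.
Qed.

Lemma changeK q : change_dom q ->
  unchange_dom (change q, q.2) /\ unchange (change q, q.2) = q.
Proof.
move=> /(new_oldK C (m0 q.2) (z q.2)) [h1 h2 h3].
rewrite /unchange_dom /unchange /back1 /back2 /= row2E0 row2E1.
rewrite ![_ * new1 _ _ _ _ _]mulrC ![_ * new2 _ _ _ _ _ _ _ _ _ _ _]mulrC.
rewrite !mulfK// h2 h3; split=> //.
by rewrite row2_coord; case: (q).
Qed.

Lemma unchangeK q : unchange_dom q -> change (unchange q) = q.1.
Proof.
move=> /old_newK[h1 h2].
rewrite /change /unchange /= row2E0 row2E1 /back1 -/(back2 q) h1 /back2 h2.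
by rewrite ![_ * (_ / _)]mulrC !divfK// row2_coord.
Qed.

Let Cc (U : set W) (j : 'I_2) : Cclass_on k U (fun q : W => q.1 0 j).
Proof.
have c1 := @fst_continuous R V P; have c2 := @coord_lin_continuous R 2 j.
have cc : continuous (@coord R 2 j \o @fst V P : W -> R).
  by move=> q; apply: continuous_comp; [exact: c1|exact: c2].
exact: (Cclass_on_lin (L := @coord R 2 j \o @fst V P) _ U cc).
Qed.

Let CP (U : set W) (h : W -> R) : Cclass k h -> Cclass_on k U h.
Proof. exact: Cclass_on_sub. Qed.

Lemma Cclass_on_row (U : set W) (a b : W -> R) : open U ->
  Cclass_on k U a -> Cclass_on k U b -> Cclass_on k U (fun q => row2 (a q) (b q)).
Proof. by move=> Uo Ca Cb; exact: Cclass_on_row2. Qed.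

Lemma Cclass_on_change (U : set W) : open U -> (forall q, U q -> change_dom q) ->
  Cclass_on k U change.
Proof.
move=> Uo Ud.
have C1 : Cclass_on k U (fun q : W => new1 al be e (q.1 0 0) (q.1 0 1)).
  by apply: Cclass_on_new1; try exact: Cc; move=> // q /Ud[].
apply: Cclass_on_row => //; apply: Cclass_onZ => //.
apply: (Cclass_on_new2 Uo A C (Cc U 1) (CP U Cm0) (CP U Cm1) (CP U Cz) C1).
by move=> q /Ud[].
Qed.

(** The inverse change is of class C^k on the open set where it is defined,
    built by imposing one condition after the other. *)
Lemma unchange_open_Cclass : exists2 O : set W,
  open O /\ O = [set q | unchange_dom q] & Cclass_on k O unchange.
Proof.
pose y1 (q : W) := q.1 0 0 / l1; pose y2 (q : W) := q.1 0 1 / l2.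
have Cy1 U : open U -> Cclass_on k U y1.
  by move=> Uo; apply: Cclass_onM; [by []|exact: Cc|exact: Cclass_onC].
have Cy2 U : open U -> Cclass_on k U y2.
  by move=> Uo; apply: Cclass_onM; [by []|exact: Cc|exact: Cclass_onC].
have n0 := @open_neq0 R.
pose c1 (q : W) := iden2 A B C (y1 q) (y2 q) (m0 q.2) (m1 q.2) (z q.2).
have Cc1 : Cclass_on k setT c1.
  by apply: Cclass_on_iden2 => //; [exact: openT|apply: Cy1; exact: openT|apply: Cy2; exact: openT].
pose O1 := setT `&` c1 @^-1` [set x | x != 0].
have O1o : open O1 by apply: (open_Cclass_cond openT Cc1).
pose c2 (q : W) := 1 + A * y1 q ^+ 2 + m1 q.2.
have Cc2 : Cclass_on k O1 c2.
  apply: Cclass_onD => //; last exact: CP.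
  by apply: Cclass_on1D => //; apply: Cclass_onZ => //; apply: Cclass_onX => //; exact: Cy1.
pose O2 := O1 `&` c2 @^-1` [set x | x != 0].
have O2o : open O2 by apply: (open_Cclass_cond O1o Cc2).
have C2 : Cclass_on k O2 back2.
  apply: (Cclass_on_old2 O2o (Cy1 _ O2o) (Cy2 _ O2o) (CP O2 Cm0) (CP O2 Cm1) (CP O2 Cz)).
  by move=> q [[_ h] _].
pose c3 (q : W) := 1 + e * back2 q ^+ 2.
have Cc3 : Cclass_on k O2 c3.
  by apply: Cclass_on1D => //; apply: Cclass_onZ => //; exact: Cclass_onX.
pose O3 := O2 `&` c3 @^-1` [set x | x != 0].
have O3o : open O3 by apply: (open_Cclass_cond O2o Cc3).
have C3 : Cclass_on k O3 back2 by apply: Cclass_on_sub C2 => q [].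
pose c4 (q : W) := iden1 be e (y1 q) (back2 q).
have Cc4 : Cclass_on k O3 c4 by apply: Cclass_on_iden1 => //; exact: Cy1.
pose O4 := O3 `&` c4 @^-1` [set x | x != 0].
have O4o : open O4 by apply: (open_Cclass_cond O3o Cc4).
have C4 : Cclass_on k O4 back2 by apply: Cclass_on_sub C3 => q [].
have Cs : Cclass_on k O4 (fun q => old_s be e (y1 q) (back2 q)).
  by apply: Cclass_on_old_s => //; [exact: Cy1|move=> q []].
pose c5 (q : W) := 1 + 2 * al * old_s be e (y1 q) (back2 q) ^+ 2.
have Cc5 : Cclass_on k O4 c5.
  by apply: Cclass_on1D => //; apply: Cclass_onZ => //; exact: Cclass_onX.
pose O5 := O4 `&` c5 @^-1` [set x | 0 < x].
have O5o : open O5 by apply: (open_Cclass_cond O4o Cc5); exact: open_gt.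
have C5 : Cclass_on k O5 back2 by apply: Cclass_on_sub C4 => q [].
exists O5.
  split=> //; apply/seteqP; split => q.
    by move=> [[[[[_ h1] h2] h3] h4] h5]; split.
  by move=> [h1 h2 h3 h4 h5]; do 5?[split=> //].
have Cb1 : Cclass_on k O5 back1.
  apply: Cclass_on_old1 => //; first by apply: Cclass_on_sub Cs => q [].
  by move=> q [].
apply: Cclass_on_pair => //; first exact: Cclass_on_row.
exact: Cclass_on_lin (@snd_continuous R V P).
Qed.

Lemma change_diffeo (U : set W) : open U -> (forall q, U q -> change_dom q) ->
  [/\ open ((fun q => (change q, q.2)) @` U),
      Cclass_on k U (fun q => (change q, q.2)),
      Cclass_on k ((fun q => (change q, q.2)) @` U) unchange &
      forall q, U q -> unchange (change q, q.2) = q].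
Proof.
move=> Uo Ud; have [D [Oo OE] CO] := unchange_open_Cclass.
have imE : (fun q => (change q, q.2)) @` U = D `&` unchange @^-1` U.
  apply/seteqP; split => q.
    move=> [q' Uq' <-]; have [h1 h2] := changeK (Ud _ Uq').
    by split; [rewrite OE|rewrite /= h2].
  move=> [Oq Uq]; exists (unchange q) => //.
  rewrite OE in Oq; rewrite unchangeK//.
  by case: (q).
have imo : open (D `&` unchange @^-1` U).
  rewrite openE => q [Oq Uq]; apply: filterI; first exact: open_nbhs_nbhs.
  have := Cclass_on_continuous CO Oq; apply; exact: open_nbhs_nbhs.
rewrite imE; split => //.
- apply: Cclass_on_pair => //; first exact: Cclass_on_change.
  exact: Cclass_on_lin (@snd_continuous R V P).
- by apply: Cclass_on_sub CO => q [].
- by move=> q Uq; have [] := changeK (Ud _ Uq).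
Qed.

End ChangeOfVariables.

(** * The transformed equations up to higher-order terms *)

Section Asymptotics.
Variables (R : realType) (T : Type) (F : filter_on T).
(* Cubic coefficients of the first component of the field, then of the second one, and
   the constants of the change of coordinates that they determine. *)
Variables (P P21 P12 P03 c Q21 Q12 Q03 : R).
Let al := - (Q12 + 2 * P21) / 6.
Let be := - (Q03 + P12) / 2.
Let e := - P03.
Let A := - Q12 / 2.
Let B := - Q03.
Let d := Q21 + 3 * P.

Variables (nx nm ne : T -> R).
Hypotheses (nx_ge0 : forall p, 0 <= nx p) (nm_ge0 : forall p, 0 <= nm p)
  (ne_ge0 : forall p, 0 <= ne p).
Local Notation vanishes := (small F (fun=> 1)).
Local Notation bounded := (big F (fun=> 1)).
Hypotheses (nx0 : vanishes nx) (nm0 : vanishes nm).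

(* [N2] and [N3] are the gauges |x|^2 + |mu| and |x|^3 + |mu||x| + |eps|. *)
Let N2 p := nx p ^+ 2 + nm p.
Let N3 p := nx p ^+ 3 + nm p * nx p + ne p.

Variables (u v m0 m1 n0 n1 z z2 zdot v1 v2 : T -> R).
Hypotheses (bu : big F nx u) (bv : big F nx v)
  (bm0 : big F nm m0) (bm1 : big F nm m1) (bn0 : big F nm n0) (bn1 : big F nm n1)
  (bz : big F ne z) (bz2 : big F ne z2) (sz : small F ne zdot).

(* [(v + L1, L2)] is the field up to higher-order terms, [z] and [z2] being its
   forcing terms, and [zdot] the time derivative of [z]. *)
Let L1 p := m0 p * u p + m1 p * v p + (P * u p ^+ 3 + P21 * u p ^+ 2 * v p
  + P12 * u p * v p ^+ 2 + P03 * v p ^+ 3) + z p.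
Let L2 p := n0 p * u p + n1 p * v p + (c * u p ^+ 3 + Q21 * u p ^+ 2 * v p
  + Q12 * u p * v p ^+ 2 + Q03 * v p ^+ 3) + z2 p.
Hypotheses (hv1 : small F N3 (fun p => v1 p - (v p + L1 p)))
  (hv2 : small F N3 (fun p => v2 p - L2 p)).

Let N2_0 : vanishes N2.
Proof.
apply: smallD nm0; apply: small_ext (vanishesM nx0 (small_big nx0)) => p.
by rewrite expr2.
Qed.

Let N2_ge0 p : 0 <= N2 p. Proof. by rewrite addr_ge0// exprn_ge0. Qed.
Let big_ge0 (N M : T -> R) : (forall p, 0 <= N p <= M p) -> big F M N.
Proof.
move=> NM; apply: big_le => p; have /andP[N0 NMp] := NM p.
by rewrite !ger0_norm// (le_trans N0).
Qed.

Let big_xx (h k : T -> R) : big F nx h -> big F nx k -> big F N2 (fun p => h p * k p).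
Proof.
move=> bh bk; apply: big_trans (bigM bh bk) _; apply: big_ge0 => p.
by rewrite mulr_ge0//= /N2 expr2 lerDl.
Qed.

Let big_m (h : T -> R) : big F nm h -> big F N2 h.
Proof.
move=> bh; apply: big_trans bh _; apply: big_ge0 => p.
by rewrite nm_ge0/= /N2 lerDr exprn_ge0.
Qed.

Let big_e (h : T -> R) : big F ne h -> big F N3 h.
Proof.
move=> bh; apply: big_trans bh _; apply: big_ge0 => p.
by rewrite ne_ge0/= /N3 lerDr addr_ge0// ?exprn_ge0// mulr_ge0.
Qed.

Let N23 : big F N3 (fun p => nx p * N2 p).
Proof.
apply: big_ge0 => p; rewrite mulr_ge0//= /N2 /N3 mulrDr -exprS.
by rewrite [nx p * nm p]mulrC lerDl.
Qed.

Let big_x2 (h k : T -> R) : big F nx h -> big F N2 k -> big F N3 (fun p => h p * k p).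
Proof. by move=> bh bk; apply: big_trans (bigM bh bk) N23. Qed.

Let small_x2 (h k : T -> R) : big F nx h -> small F N2 k -> small F N3 (fun p => h p * k p).
Proof.
move=> bh sk; apply: small_ext (small_trans (smallM sk bh) _) => [p|].
  by rewrite mulrC.
by apply: big_ext N23 => p; rewrite mulrC.
Qed.

Let w p := scale1 al (u p).
Let D p := den1 al be (u p) (v p).
Let Y p := new1 al be e (u p) (v p).
Let n p := den2 al be e B (u p) (v p).
Let a p := num2 al be e A (u p) (v p) (m1 p).
Let Y2 p := new2 al be e A B P (u p) (v p) (m0 p) (m1 p) (z p).

Let jw : jet F N2 (fun p => al * (u p * u p)) w.
Proof.
have bt : big F N2 (fun p => 2 * al * (u p * u p)) by apply: bigZ; exact: big_xx.
apply: jet_eq (jet_invsqrt N2_0 bt) _ _ => p; first by field.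
by rewrite /w /scale1 expr2.
Qed.

Let bw : bounded w. Proof. exact: (jet_bounded N2_0 jw). Qed.
Let bs : big F nx (fun p => u p * w p). Proof. exact: bigMr. Qed.

Let jD : jet F N2 (fun p => be * (u p * v p)) (fun p => (D p)^-1).
Proof.
have bt : big F N2 (fun p => be * (u p * w p * v p)) by apply: bigZ; exact: big_xx.
have jt := jet_inv N2_0 bt.
apply: (@jet_congr _ _ F N2 (fun p => be * (u p * w p * v p))).
  by apply: jet_eq jt _ _ => // p; rewrite /D /den1 -/(w p); congr (_^-1); ring.
apply: small_ext (smallZ be (bigM_vanishes (big_xx bu bv) (jet_vanishes N2_0 jw))) => p.
by ring.
Qed.

Let je : jet F N2 (fun p => e * (v p * v p)) (fun p => 1 + e * v p ^+ 2).
Proof.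
by apply: jet_eq (jet_affine (bigZ e (big_xx bv bv))) _ _.
Qed.

Let jY : jet F N2 (fun p => al * (u p * u p) + e * (v p * v p) + be * (u p * v p))
  (fun p => w p * (1 + e * v p ^+ 2) * (D p)^-1).
Proof. exact: (jetM N2_0 (jetM N2_0 jw je) jD). Qed.

Let YE p : Y p = u p * (w p * (1 + e * v p ^+ 2) * (D p)^-1).
Proof. by []. Qed.

Let bY : big F nx Y.
Proof. by apply: bigMr => //; exact: (jet_bounded N2_0 jY). Qed.

Let bYu : big F N3 (fun p => Y p - u p).
Proof.
apply: big_ext (big_x2 bu (jet_big jY)) => p.
by rewrite YE mulrBr mulr1.
Qed.

Let jn : jet F N2 (fun p => B * (u p * v p)) (fun p => (n p)^-1).
Proof.
have bt : big F N2 (fun p => B * (Y p * v p)) by apply: bigZ; exact: big_xx.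
apply: (@jet_congr _ _ F N2 (fun p => B * (Y p * v p))).
  by apply: jet_eq (jet_inv N2_0 bt) _ _ => // p; rewrite /n /den2 -/(Y p); congr (_^-1); ring.
apply: small_ext (smallZ B (bigM_vanishes (big_xx bu bv) (jet_vanishes N2_0 jY))) => p.
by rewrite YE; ring.
Qed.

Let ja : jet F N2 (fun p => A * (u p * u p) + m1 p) a.
Proof.
have bt : big F N2 (fun p => A * (Y p * Y p) + m1 p).
  by apply: bigD; [apply: bigZ; exact: big_xx|exact: big_m].
apply: (@jet_congr _ _ F N2 (fun p => A * (Y p * Y p) + m1 p)).
  by apply: jet_eq (jet_affine bt) _ _ => // p; rewrite /a /num2 -/(Y p) expr2.
have s1 := bigM_vanishes (big_xx bu bu) (jet_vanishes N2_0 (jetM N2_0 jY jY)).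
apply: small_ext (smallZ A s1) => p.
by rewrite YE; ring.
Qed.

Let jan := jetM N2_0 ja jn.

Let l2 p := A * (u p * u p) + m1 p + B * (u p * v p).

(* Since Y - u = O(N3), the terms m0 Y and P Y^3 may be computed at u. *)
Let hY2 : small F N3 (fun p => Y2 p - (v p + v p * l2 p + m0 p * u p + P * u p ^+ 3 + z p)).
Proof.
have s1 : small F N3 (fun p => v p * (a p * (n p)^-1 - 1 - l2 p)).
  by apply: small_x2 => //; case: jan.
have s2 : small F N3 (fun p => m0 p * (Y p - u p)).
  exact: vanishesM (big_small bm0 nm0) bYu.
have bq : vanishes (fun p => Y p * Y p + Y p * u p + u p * u p).
  by apply: bigN_vanishes N2_0 _ _; do 2?apply: bigD; exact: big_xx.
have s3 := smallZ P (bigM_vanishes bYu bq).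
apply: small_ext (smallD (smallD s1 s2) s3) => p.
by rewrite /Y2 /new2 -/(Y p) -/(n p) -/(a p) /l2; ring.
Qed.

Let bl2 : big F N2 l2. Proof. by case: jan. Qed.

Let bL1 : big F N3 L1.
Proof.
have b1 := big_x2 bu (big_m bm0); have b2 := big_x2 bv (big_m bm1).
have b3 := bigZ P (big_x2 bu (big_xx bu bu)).
have b4 := bigZ P21 (big_x2 bv (big_xx bu bu)).
have b5 := bigZ P12 (big_x2 bu (big_xx bv bv)).
have b6 := bigZ P03 (big_x2 bv (big_xx bv bv)).
apply: big_ext (bigD (bigD (bigD b1 b2) (bigD (bigD (bigD b3 b4) b5) b6)) (big_e bz)) => p.
by rewrite /L1; ring.
Qed.

Let bL2 : big F N3 L2.
Proof.
have b1 := big_x2 bu (big_m bn0); have b2 := big_x2 bv (big_m bn1).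
have b3 := bigZ c (big_x2 bu (big_xx bu bu)).
have b4 := bigZ Q21 (big_x2 bv (big_xx bu bu)).
have b5 := bigZ Q12 (big_x2 bu (big_xx bv bv)).
have b6 := bigZ Q03 (big_x2 bv (big_xx bv bv)).
apply: big_ext (bigD (bigD (bigD b1 b2) (bigD (bigD (bigD b3 b4) b5) b6)) (big_e bz2)) => p.
by rewrite /L2; ring.
Qed.

Let bY2v : big F N3 (fun p => Y2 p - v p).
Proof.
have b1 := big_x2 bv bl2; have b2 := big_x2 bu (big_m bm0).
have b3 := bigZ P (big_x2 bu (big_xx bu bu)).
apply: big_ext (bigD (small_big hY2) (bigD (bigD (bigD b1 b2) b3) (big_e bz))) => p.
by ring.
Qed.

Let bv1 : big F N3 (fun p => v1 p - v p).
Proof. by apply: big_ext (bigD (small_big hv1) bL1) => p; ring. Qed.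

Let bv2 : big F N3 v2.
Proof. by apply: big_ext (bigD (small_big hv2) bL2) => p; ring. Qed.

(* The velocities of the new coordinates along the field [(v1, v2)]. *)
Let ydot1 p := d11 al be e (u p) (v p) * v1 p + d12 al be e (u p) (v p) * v2 p.
Let ydot2 p := d22 al be e A B (u p) (v p) (m1 p) * v2 p
  + ydot1 p * d21 al be e A B P (u p) (v p) (m0 p) (m1 p) + zdot p.

Let l11 p := 3 * al * (u p * u p) + e * (v p * v p) + 2 * be * (u p * v p).

Let j11 : jet F N2 l11 (fun p => d11 al be e (u p) (v p)).
Proof.
have j := jetM N2_0 (jetM N2_0 (jetM N2_0 jw (jetM N2_0 jw jw)) je) (jetM N2_0 jD jD).
apply: jet_eq j _ _ => p; first by rewrite /l11; ring.
by rewrite /d11 -/(w p) -/(D p); ring.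
Qed.

Let s12 : vanishes (fun p => d12 al be e (u p) (v p)).
Proof.
have bD := jet_bounded N2_0 jD; have bE := jet_bounded N2_0 je.
have s1 := smallMl (bigN_vanishes N2_0 (big_xx bs bv)) bD.
have s2 := smallMl (smallMl (bigN_vanishes N2_0 (big_xx bs bs)) bE) (bigMr bD bD).
apply: small_ext (smallD (smallZ (2 * e) s1) (smallZ be s2)) => p.
by rewrite /d12 -/(w p) -/(D p); ring.
Qed.

Lemma first_equation : small F N3 (fun p => ydot1 p - Y2 p).
Proof.
have [bl11 sl11] := j11.
have s1 : small F N3 (fun p => v p * (d11 al be e (u p) (v p) - 1 - l11 p)).
  exact: small_x2.
have s2 : small F N3 (fun p => (d11 al be e (u p) (v p) - 1) * (v1 p - v p)).
  exact: vanishesM (jet_vanishes N2_0 j11) bv1.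
have s3 : small F N3 (fun p => d12 al be e (u p) (v p) * v2 p) by exact: vanishesM.
apply: small_ext (smallB (smallD (smallD (smallD s1 s2) s3) hv1) hY2) => p.
by rewrite /ydot1 /L1 /l11 /l2 /al /be /e /A /B; field.
Qed.

Let by1 : big F N3 (fun p => ydot1 p - v p).
Proof.
by apply: big_ext (bigD (small_big first_equation) bY2v) => p; ring.
Qed.

Let l21 p := 2 * A * (u p * v p) + B * (v p * v p) + m0 p + 3 * P * (u p * u p).

Let h21 : small F N2 (fun p => d21 al be e A B P (u p) (v p) (m0 p) (m1 p) - l21 p).
Proof.
have s1 := bigM_vanishes (big_xx bu bv) (jet_vanishes N2_0 (jetM N2_0 jY jn)).
have s2 := bigM_vanishes (big_xx bv bv) (jet_vanishes N2_0 (jetM N2_0 ja (jetM N2_0 jn jn))).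
have s3 := bigM_vanishes (big_xx bu bu) (jet_vanishes N2_0 (jetM N2_0 jY jY)).
apply: small_ext (smallD (smallD (smallZ (2 * A) s1) (smallZ B s2)) (smallZ (3 * P) s3)) => p.
by rewrite /d21 -/(Y p) -/(n p) -/(a p) YE /l21; ring.
Qed.

Let s21 : vanishes (fun p => d21 al be e A B P (u p) (v p) (m0 p) (m1 p)).
Proof.
have bl : big F N2 l21.
  apply: bigD; last by apply: bigZ; exact: big_xx.
  apply: bigD; last exact: big_m.
  by apply: bigD; apply: bigZ; exact: big_xx.
apply: bigN_vanishes N2_0 _ _.
by apply: big_ext (bigD (small_big h21) bl) => p; ring.
Qed.

Lemma second_equation : small F N3 (fun p => ydot2 p -
  (n0 p * Y p + (m0 p + n1 p) * Y2 p + c * Y p ^+ 3 + d * Y p ^+ 2 * Y2 p + z2 p)).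
Proof.
have j22 := jetM N2_0 ja (jetM N2_0 jn jn).
have s1 := vanishesM (jet_vanishes N2_0 j22) bv2.
have s2 := bigM_vanishes by1 s21.
have s3 := small_x2 bv h21.
have s4 := small_trans sz (big_e (big_refl F ne)).
have vm (h : T -> R) : big F nm h -> vanishes h by move=> bh; exact: big_small bh nm0.
have s5 := vanishesM (vm _ bn0) bYu.
have s6 := vanishesM (smallD (vm _ bm0) (vm _ bn1)) bY2v.
have bq : vanishes (fun p => Y p * Y p + Y p * u p + u p * u p).
  by apply: bigN_vanishes N2_0 _ _; do 2?apply: bigD; exact: big_xx.
have s7 := smallZ c (bigM_vanishes bYu bq).
have s8 := smallZ d (vanishesM (bigN_vanishes N2_0 (big_xx bY bY)) bY2v).
have bq' : vanishes (fun p => (Y p + u p) * v p).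
  by apply: bigN_vanishes N2_0 _ _; apply: big_xx => //; exact: bigD.
have s9 := smallZ d (bigM_vanishes bYu bq').
apply: small_ext (smallB (smallD (smallD (smallD (smallD s1 hv2) s2) s3) s4)
  (smallD (smallD (smallD (smallD s5 s6) s7) s8) s9)) => p.
rewrite /ydot2 /d22 -/(n p) -/(a p) /L2 /l21 /d /A /B.
by move: (n p)^-1 => i; field.
Qed.

Lemma dom_new_near :
  \forall p \near F, dom_new al be e A B (u p) (v p) (m1 p).
Proof.
have bt : big F N2 (fun p => - (2 * al) * (u p * u p)) by apply: bigZ; exact: big_xx.
have g1 := near1_pos (jet_vanishes N2_0 (jet_affine bt)).
have g2 := near1_pos (jet_vanishes N2_0 jD).
have g3 := near1_pos (jet_vanishes N2_0 je).
have g4 := near1_pos (jet_vanishes N2_0 jn).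
have g5 := near1_pos (jet_vanishes N2_0 ja).
have inv0 (t : R) : 1 / 2 <= t^-1 -> t != 0.
  by move=> h; apply/eqP => t0; move: h; rewrite t0 invr0; lra.
near=> p; split.
- have : 1 / 2 <= 1 + - (2 * al) * (u p * u p) by near: p.
  by rewrite expr2; lra.
- by apply: inv0; near: p.
- by have h : 1 / 2 <= 1 + e * v p ^+ 2; [near: p|apply: lt0r_neq0; lra].
- by apply: inv0; near: p.
- by have h : 1 / 2 <= a p; [near: p|apply: lt0r_neq0; rewrite -/(a p); lra].
Unshelve. all: by end_near. Qed.

End Asymptotics.

(** The old coordinates are bounded by the new ones and [eps], and the inverse change
    is defined near the origin. *)
Section InverseBounds.
Variables (R : realType) (T : Type) (F : filter_on T).
Variables (al be e A B P : R) (nx nm ne : T -> R).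
Hypotheses (nx_ge0 : forall p, 0 <= nx p) (ne_ge0 : forall p, 0 <= ne p).
Local Notation vanishes := (small F (fun=> 1)).
Local Notation bounded := (big F (fun=> 1)).
Hypotheses (nx0 : vanishes nx) (nm0 : vanishes nm) (ne0 : vanishes ne).
Variables (y1 y2 m0 m1 z : T -> R).
Hypotheses (by1 : big F nx y1) (by2 : big F nx y2)
  (bm0 : big F nm m0) (bm1 : big F nm m1) (bz : big F ne z).

Let N p := nx p + ne p.
Let N0 : vanishes N. Proof. exact: smallD. Qed.
Let xN (h : T -> R) : big F nx h -> big F N h.
Proof.
move=> bh; apply: big_trans bh _; apply: big_le => p.
by rewrite !ger0_norm ?addr_ge0// lerDl.
Qed.
Let eN (h : T -> R) : big F ne h -> big F N h.
Proof.
move=> bh; apply: big_trans bh _; apply: big_le => p.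
by rewrite !ger0_norm ?addr_ge0// lerDr.
Qed.
Let mv (h : T -> R) : big F nm h -> vanishes h.
Proof. by move=> bh; exact: big_small bh nm0. Qed.
Let Nv (h : T -> R) : big F N h -> vanishes h.
Proof. by move=> bh; exact: big_small bh N0. Qed.

Let V p := old2 A B P (y1 p) (y2 p) (m0 p) (m1 p) (z p).
Let S p := old_s be e (y1 p) (V p).

Let b1 := xN by1.
Let b2 := xN by2.

Let bZ : big F N (fun p => old_z P (y1 p) (y2 p) (m0 p) (z p)).
Proof.
have h1 := small_big (vanishesM (mv bm0) b1).
have h2 := bigZ P (small_big (vanishesM (Nv (small_big (vanishesM (Nv b1) b1))) b1)).
apply: big_ext (bigB (bigB (bigB b2 h1) h2) (eN bz)) => p.
by rewrite /old_z; ring.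
Qed.

Let sD2 : vanishes (fun p => iden2 A B P (y1 p) (y2 p) (m0 p) (m1 p) (z p) - 1).
Proof.
have h1 := smallZ A (vanishesM (Nv b1) (small_big (Nv b1))).
have h2 := smallZ B (vanishesM (Nv b1) (small_big (Nv bZ))).
apply: small_ext (smallD (smallD h1 (mv bm1)) h2) => p.
by rewrite /iden2; ring.
Qed.

Lemma old2_big : big F N V.
Proof. exact: bigMr bZ (near1_inv sD2). Qed.

Let sD1 : vanishes (fun p => iden1 be e (y1 p) (V p) - 1).
Proof.
have h1 := smallZ e (vanishesM (Nv old2_big) (small_big (Nv old2_big))).
have h2 := smallZ be (vanishesM (Nv b1) (small_big (Nv old2_big))).
apply: small_ext (smallD h1 h2) => p.
by rewrite /iden1; ring.
Qed.

Let bS : big F N S.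
Proof. exact: bigMr b1 (near1_inv sD1). Qed.

Let bSS : big F N (fun p => - (2 * al) * (S p * S p)).
Proof. by apply: bigZ; apply: small_big; exact: vanishesM (Nv bS) bS. Qed.

Lemma old1_big : big F N (fun p => old1 al (S p)).
Proof.
have h := jet_bounded N0 (jet_invsqrt N0 bSS).
apply: big_ext (bigMr bS h) => p.
by rewrite /old1; congr (_ * (Num.sqrt _)^-1); ring.
Qed.

Lemma dom_old_near :
  \forall p \near F, dom_old al be e A B P (y1 p) (y2 p) (m0 p) (m1 p) (z p).
Proof.
have g1 := near1_pos sD2.
have h2 := smallZ A (vanishesM (Nv b1) (small_big (Nv b1))).
have g2 : \forall p \near F, 1 / 2 <= 1 + A * y1 p ^+ 2 + m1 p.
  apply: near1_pos; apply: small_ext (smallD h2 (mv bm1)) => p; ring.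
have h3 := smallZ e (vanishesM (Nv old2_big) (small_big (Nv old2_big))).
have g3 : \forall p \near F, 1 / 2 <= 1 + e * V p ^+ 2.
  apply: near1_pos; apply: small_ext h3 => p; ring.
have g4 := near1_pos sD1.
have g5 : \forall p \near F, 1 / 2 <= 1 + 2 * al * S p ^+ 2.
  apply: near1_pos; apply: small_ext (smallN (Nv bSS)) => p; ring.
near=> p; split; try apply: lt0r_neq0.
- by apply: (@lt_le_trans _ _ (1 / 2)); [lra|near: p].
- by apply: (@lt_le_trans _ _ (1 / 2)); [lra|near: p].
- by apply: (@lt_le_trans _ _ (1 / 2)); [lra|near: p].
- by apply: (@lt_le_trans _ _ (1 / 2)); [lra|near: p].
- by apply: (@lt_le_trans _ _ (1 / 2)); [lra|near: p].
Unshelve. all: by end_near. Qed.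

End InverseBounds.

(** * Expansions near the origin, uniform in the phase *)

Section NearOrigin.
Variable R : realType.
Local Notation V := 'rV[R]_2.
Local Notation W := (V * (V * R * R))%type.

(** Points [((x, (mu, eps, phi)), omega)] with [x], [mu], [eps], [omega] close to 0,
    uniformly in the phase [phi]. *)
Definition near_origin : set_system (W * R) :=
  filter_from [set r : R | 0 < r] (fun r => [set p | tube r p.1 /\ `|p.2| < r]).

Lemma near_origin_filter : Filter near_origin.
Proof.
apply: filter_from_filter; first by exists 1 => /=.
move=> r s /= r0 s0; exists (Num.min r s); first by rewrite /= lt_min r0.
move=> p [[]]; rewrite !lt_min => /andP[a1 a2] /andP[b1 b2] /andP[c1 c2] /andP[d1 d2].
by do !split.
Qed.

Definition origin : filter_on (W * R) := FilterType near_origin near_origin_filter.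

Lemma near_originP (Q : W * R -> Prop) : (\forall p \near origin, Q p) <->
  exists2 r, 0 < r & forall p, tube r p.1 -> `|p.2| < r -> Q p.
Proof.
split=> [[r r0 rQ]|[r r0 rQ]]; exists r => // p.
  by move=> h1 h2; apply: rQ.
by move=> [h1 h2]; apply: rQ.
Qed.

(** Components of a point. *)
Definition px (p : W * R) : V := p.1.1.
Definition pmu (p : W * R) : V := p.1.2.1.1.
Definition peps (p : W * R) : R := p.1.2.1.2.
Definition pphi (p : W * R) : R := p.1.2.2.
Definition pom (p : W * R) : R := p.2.

Local Notation vanishes := (small origin (fun=> 1)).

Lemma vanishes_x : vanishes (fun p => `|px p|).
Proof.
move=> d d0; apply/near_originP; exists d => // p [h _ _] _.
by rewrite normr1 mulr1 normr_id ltW.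
Qed.
Lemma vanishes_mu : vanishes (fun p => `|pmu p|).
Proof.
move=> d d0; apply/near_originP; exists d => // p [_ h _] _.
by rewrite normr1 mulr1 normr_id ltW.
Qed.
Lemma vanishes_eps : vanishes (fun p => `|peps p|).
Proof.
move=> d d0; apply/near_originP; exists d => // p [_ _ h] _.
by rewrite normr1 mulr1 normr_id ltW.
Qed.
Lemma vanishes_om : vanishes pom.
Proof.
move=> d d0; apply/near_originP; exists d => // p _ h.
by rewrite normr1 mulr1 ltW.
Qed.

Lemma big_coord (j : 'I_2) : big origin (fun p => `|px p|) (fun p => px p 0 j).
Proof. by apply: big_le => p; rewrite normr_id norm_coord_le. Qed.

End NearOrigin.

Section ParameterMaps.
Variable R : realType.
Local Notation V := 'rV[R]_2.
Local Notation W := (V * (V * R * R))%type.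

Lemma is_derive_lin (V1 V2 : normedModType R) (L : {linear V1 -> V2}) (q v : V1) :
  continuous L -> is_derive q v L (L v).
Proof.
move=> Lc; have dL := linear_differentiable q Lc.
apply: DeriveDef; first exact: diff_derivable.
by rewrite deriveE// (diff_lin q Lc).
Qed.

(** Linear maps reading the components of a point of the extended phase space. *)
Definition eps_lin : {linear W -> R} :=
  @snd V R \o (@fst (V * R)%type R \o @snd V (V * R * R)%type).
Lemma eps_continuous : continuous eps_lin.
Proof.
move=> p; apply: continuous_comp; last exact: (@snd_continuous R V R).
apply: continuous_comp; last exact: (@fst_continuous R (V * R)%type R).
exact: (@snd_continuous R V (V * R * R)%type).
Qed.

Definition phase_lin : {linear W -> (V * R)%type} :=
  @inj2 R V R \o (@snd (V * R)%type R \o @snd V (V * R * R)%type).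
Lemma phase_continuous : continuous phase_lin.
Proof.
move=> p; apply: continuous_comp; last exact: (@inj2_continuous R V R).
apply: continuous_comp; last exact: (@snd_continuous R (V * R)%type R).
exact: (@snd_continuous R V (V * R * R)%type).
Qed.

Definition x_lin (j : 'I_2) : {linear W -> R} := @coord R 2 j \o @fst V (V * R * R)%type.
Lemma x_continuous (j : 'I_2) : continuous (x_lin j).
Proof.
move=> q; apply: continuous_comp; last exact: coord_lin_continuous.
exact: fst_continuous.
Qed.

Definition mu_lin (j : 'I_2) : {linear W -> R} :=
  @coord R 2 j \o (@fst V R \o (@fst (V * R)%type R \o @snd V (V * R * R)%type)).
Lemma mu_continuous (j : 'I_2) : continuous (mu_lin j).
Proof.
move=> p; apply: continuous_comp; last exact: coord_lin_continuous.
apply: continuous_comp; last exact: (@fst_continuous R V R).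
apply: continuous_comp; last exact: (@fst_continuous R (V * R)%type R).
exact: (@snd_continuous R V (V * R * R)%type).
Qed.

End ParameterMaps.

Section Field.
Variable R : realType.
Local Notation V := 'rV[R]_2.
Local Notation W := (V * (V * R * R))%type.
Variables (f : V * V -> V) (g : V * R -> V).
Hypotheses (f_C4 : Cclass 4 f) (f_odd : forall x mu, f (- x, mu) = - f (x, mu))
  (f_lin : (jacobian (fun x => f (x, 0)) 0)^T = delta_mx 0 1)
  (g_C2 : Cclass 2 g) (g_per : forall x phi, g (x, phi + 2 * pi) = g (x, phi)).

(** The vector field, with the phase as a parameter. *)
Definition vfield (q : W) : V := f (q.1, q.2.1.1) + q.2.1.2 *: g (q.1, q.2.2).

Lemma vfieldE q j : vfield q 0 j =
  f (q.1, q.2.1.1) 0 j + q.2.1.2 * g (q.1, q.2.2) 0 j.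
Proof. by rewrite /vfield mxE [X in _ + X]mxE. Qed.

Let nx (p : W * R) := `|px p|.
Let nm (p : W * R) := `|pmu p|.
Let ne (p : W * R) := `|peps p|.
Let N3 p := nx p ^+ 3 + nm p * nx p + ne p.

Lemma lin_mu_big (j k : 'I_2) : big (origin R) nm (fun p => lin_mu f j k (pmu p)).
Proof.
have b (l : 'I_2) : big (origin R) nm (fun p => pmu p 0 l).
  by apply: big_le => p; rewrite normr_id norm_coord_le.
exact: bigD (bigZ _ (b 0)) (bigZ _ (b 1)).
Qed.

Let g_cont : continuous g.
Proof. by move=> p; exact: (Cclass_on_continuous g_C2 I). Qed.

Lemma forcing_big (j : 'I_2) :
  big (origin R) ne (fun p => peps p * g (0, pphi p) 0 j).
Proof.
have [M M0 gM] := periodic_bounded g_cont g_per.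
exists M => //; apply/near_originP; exists 1 => // p _ _.
rewrite normrM mulrC normr_id ler_wpM2r//.
by apply: le_trans (gM (pphi p)); exact: norm_coord_le.
Qed.

Lemma vfield_small (j : 'I_2) : small (origin R) N3 (fun p => vfield p.1 0 j -
  ((j == 0)%:R * px p 0 1 + lin_mu f j 0 (pmu p) * px p 0 0
   + lin_mu f j 1 (pmu p) * px p 0 1 + cubic f j (px p 0 0) (px p 0 1)
   + peps p * g (0, pphi p) 0 j)).
Proof.
have N30 p : 0 <= N3 p by rewrite /N3 !addr_ge0 ?mulr_ge0 ?exprn_ge0 /nx /nm /ne.
have s1 : small (origin R) N3 (fun p => f (px p, pmu p) 0 j -
   ((j == 0)%:R * px p 0 1 + lin_mu f j 0 (pmu p) * px p 0 0
   + lin_mu f j 1 (pmu p) * px p 0 1 + cubic f j (px p 0 0) (px p 0 1))).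
  move=> d d0; have [r r0 rP] := field_expansion f_C4 f_odd f_lin j d0.
  apply/near_originP; exists r => // p [h1 h2 _] _.
  apply: le_trans (rP _ _ h1 h2) _; rewrite ger0_norm//.
  by apply: ler_wpM2l; [exact: ltW|rewrite /N3 lerDl /ne].
have s2 : small (origin R) (fun=> 1) (fun p => g (px p, pphi p) 0 j - g (0, pphi p) 0 j).
  move=> d d0; have := periodic_uniformly_continuous0 g_cont g_per d0.
  move=> /nbhs_ballP[r r0 rP]; apply/near_originP; exists r => // p [h1 _ _] _.
  rewrite normr1 mulr1; have := rP (px p) _ (pphi p).
  rewrite -ball_normE/= sub0r normrN => /(_ h1); apply: le_trans.
  rewrite (_ : _ - _ = (g (px p, pphi p) - g (0, pphi p)) 0 j) ?norm_coord_le//.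
  by rewrite !mxE.
have s3 : small (origin R) ne (fun p => peps p * (g (px p, pphi p) 0 j - g (0, pphi p) 0 j)).
  by apply: bigM_vanishes s2; apply: big_le => p; rewrite normr_id.
have s4 : small (origin R) N3 (fun p => peps p * (g (px p, pphi p) 0 j - g (0, pphi p) 0 j)).
  apply: small_trans s3 _; apply: big_le => p; rewrite normr_id [leRHS]ger0_norm//.
  by rewrite /N3 lerDr /nx /nm addr_ge0 ?exprn_ge0 ?mulr_ge0.
apply: small_ext (smallD s1 s4) => p.
rewrite vfieldE -/(px p) -/(pmu p) -/(peps p) -/(pphi p).
by rewrite mulrBr [in RHS]opprD [RHS]addrACA.
Qed.

(** The derivative of the first forcing component along the phase. *)
Definition gdot (phi : R) : R := 'D_(0, 1) g (0, phi) 0 0.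

Lemma gdot_bounded : exists2 M : R, 0 < M & forall phi, `|gdot phi| <= M.
Proof.
have [dg Dg] := g_C2; have [dD _] := Dg (0, 1).
pose h (p : V * R) := 'D_((0, 1) : V * R) g p.
have hc : continuous h by move=> p; exact/differentiable_continuous/dD.
have hper x phi : h (x, phi + 2 * pi) = h (x, phi).
  have E : (fun p => g (p + (0, 2 * pi))) = g.
    by apply/funext => -[y psi]; rewrite -[X in g X]/(y + 0, psi + 2 * pi) addr0 g_per.
  rewrite /h -[in RHS]E.
  have -> : (x, phi + 2 * pi) = (x, phi) + (0, 2 * pi) :> V * R.
    by rewrite -[RHS]/(x + 0, phi + 2 * pi) addr0.
  have quotE (t : R) : t^-1 *: ((g \o shift ((x, phi) + (0, 2 * pi))) (t *: (0, 1)) -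
      g ((x, phi) + (0, 2 * pi))) = t^-1 *: (((fun p => g (p + (0, 2 * pi)))
      \o shift (x, phi)) (t *: (0, 1)) - g ((x, phi) + (0, 2 * pi))).
    by rewrite /= addrA.
  by rewrite /derive (funext quotE).
have [M M0 hM] := periodic_bounded hc hper.
exists M => // phi; apply: le_trans (hM phi); exact: norm_coord_le.
Qed.

Lemma zdot_small : small (origin R) ne (fun p => peps p * (pom p * gdot (pphi p))).
Proof.
have [M M0 hM] := gdot_bounded.
apply: bigM_vanishes; first by apply: big_le => p; rewrite normr_id.
apply: smallMl; first exact: vanishes_om.
exists M => //; apply/near_originP; exists 1 => // p _ _.
by rewrite normr1 mulr1.
Qed.

(** The forcing of the first equation at [x = 0], absorbed in the change of
    coordinates. *)
Definition zforce (p : V * R * R) : R := p.1.2 * g (0, p.2) 0 0.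

Lemma zforce_Cclass : Cclass 2 (fun q : W => zforce q.2).
Proof.
apply: (Cclass_onM openT); first exact: (Cclass_on_lin _ setT (@eps_continuous R)).
apply: (Cclass_on_postlin (L := @coord R 2 0)); [exact: openT|exact: coord_lin_continuous|].
exact: (Cclass_on_prelin openT (@phase_continuous R) g_C2).
Qed.

Lemma lin_mu_Cclass (j k : 'I_2) n : Cclass n (fun q : W => lin_mu f j k q.2.1.1).
Proof.
have cm (l : 'I_2) : Cclass n (fun q : W => q.2.1.1 0 l).
  exact: (Cclass_on_lin _ setT (@mu_continuous R l)).
by apply: (Cclass_onD openT); apply: (Cclass_onZ openT); exact: cm.
Qed.

End Field.

(** * The normal form *)

Section Main.
Variable R : realType.
Local Notation V := 'rV[R]_2.
Local Notation W := (V * (V * R * R))%type.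
Variables (f : V * V -> V) (g : V * R -> V).
Hypotheses (f_C4 : Cclass 4 f) (f_odd : forall x mu, f (- x, mu) = - f (x, mu))
  (f_lin : (jacobian (fun x => f (x, 0)) 0)^T = delta_mx 0 1)
  (g_C2 : Cclass 2 g) (g_per : forall x phi, g (x, phi + 2 * pi) = g (x, phi))
  (c_neq0 : coef_c f != 0) (d_neq0 : coef_d f != 0).

(** Cubic coefficients of the field, [cf] for its first component and [cq] for its
    second one; the digits are the exponents of [x_1] and [x_2]. *)
Definition cf30 := coef_a f 0 3 0 / 6.
Definition cf21 := coef_a f 0 2 1 / 2.
Definition cf12 := coef_a f 0 1 2 / 2.
Definition cf03 := coef_a f 0 0 3 / 6.
Definition cq21 := coef_a f 1 2 1 / 2.
Definition cq12 := coef_a f 1 1 2 / 2.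
Definition cq03 := coef_a f 1 0 3 / 6.

(** Constants of the change of coordinates: [nf_al] and [nf_be] are the coefficients of
    [u^3] and [u^2 v] in [p] for which the second equation has no [u v^2] and no [v^3];
    [nf_e], the coefficient of [u v^2] in [p], removes [v^3] from [y2]; and [nf_A], [nf_B] are
    the resulting coefficients of [u^2 v] and [u v^2] in [y2]. *)
Definition nf_al := - (cq12 + 2 * cf21) / 6.
Definition nf_be := - (cq03 + cf12) / 2.
Definition nf_e := - cf03.
Definition nf_A := - cq12 / 2.
Definition nf_B := - cq03.

(** Scales of time and space. *)
Definition kappa := `|coef_c f / coef_d f|.
Definition lam1 := `|coef_d f| / Num.sqrt `|coef_c f|.
Definition lam2 := lam1 / kappa.

(** First row of the perturbation of the linear part. *)
Definition mu0 (p : V * R * R) : R := lin_mu f 0 0 p.1.1.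
Definition mu1 (p : V * R * R) : R := lin_mu f 0 1 p.1.1.

(** The change of coordinates of the theorem, and its inverse. *)
Definition Phi : W -> V :=
  change nf_al nf_be nf_e nf_A nf_B cf30 lam1 lam2 mu0 mu1 (zforce g).
Definition Psi : W -> W :=
  unchange nf_al nf_be nf_e nf_A nf_B cf30 lam1 lam2 mu0 mu1 (zforce g).

(** The unscaled new coordinates and their velocities. *)
Definition Y1 (q : W) := new1 nf_al nf_be nf_e (q.1 0 0) (q.1 0 1).
Definition Y2 (q : W) := new2 nf_al nf_be nf_e nf_A nf_B cf30
  (q.1 0 0) (q.1 0 1) (mu0 q.2) (mu1 q.2) (zforce g q.2).

Definition ydot1 (q : W) := d11 nf_al nf_be nf_e (q.1 0 0) (q.1 0 1) * vfield f g q 0 0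
  + d12 nf_al nf_be nf_e (q.1 0 0) (q.1 0 1) * vfield f g q 0 1.
Definition ydot2 (q : W) (om : R) :=
  d22 nf_al nf_be nf_e nf_A nf_B (q.1 0 0) (q.1 0 1) (mu1 q.2) * vfield f g q 0 1
  + ydot1 q * d21 nf_al nf_be nf_e nf_A nf_B cf30 (q.1 0 0) (q.1 0 1) (mu0 q.2) (mu1 q.2)
  + q.2.1.2 * (om * gdot g q.2.2).

Let sc := Num.sqrt `|coef_c f|.
Let sc0 : 0 < sc. Proof. by rewrite sqrtr_gt0 normr_gt0. Qed.
Let scE : `|coef_c f| = sc ^+ 2. Proof. by rewrite sqr_sqrtr. Qed.
Let d0 : 0 < `|coef_d f|. Proof. by rewrite normr_gt0. Qed.

Let kappaE : kappa = sc ^+ 2 / `|coef_d f|.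
Proof. by rewrite /kappa normf_div scE. Qed.

Lemma kappa_gt0 : 0 < kappa.
Proof. by rewrite kappaE divr_gt0// exprn_gt0. Qed.

Lemma kappaV : kappa^-1 = `|coef_d f / coef_c f|.
Proof. by rewrite /kappa !normf_div invf_div. Qed.

Lemma lam1_neq0 : lam1 != 0.
Proof. by rewrite mulf_neq0 ?invr_neq0 ?gt_eqF. Qed.

Lemma lam2_neq0 : lam2 != 0.
Proof. by rewrite mulf_neq0 ?lam1_neq0 ?invr_neq0 ?gt_eqF// kappa_gt0. Qed.

(** The scales turn the cubic coefficients [c] and [d] into their signs. *)
Lemma scale_c : lam2 / kappa * coef_c f = Num.sg (coef_c f) * lam1 ^+ 3.
Proof.
rewrite {1}[coef_c f]numEsg scE /lam2 kappaE /lam1 -/sc.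
by field; rewrite !gt_eqF.
Qed.

Lemma scale_d : lam2 / kappa * coef_d f = Num.sg (coef_d f) * lam1 ^+ 2 * lam2.
Proof.
rewrite {1}[coef_d f]numEsg /lam2 kappaE /lam1 -/sc.
by field; rewrite !gt_eqF.
Qed.

Lemma scale_forcing : `|coef_d f| ^+ 3 / `|coef_c f| `^ (5 / 2) = lam2 / kappa.
Proof.
have -> : `|coef_c f| `^ (5 / 2) = sc ^+ 5.
  have c0 : 0 <= `|coef_c f| by [].
  have -> : 5 / 2 = 2^-1 * 5%:R :> R by field.
  by rewrite powRrM powR12_sqrt// -/sc powR_mulrn// ltW.
rewrite /lam2 kappaE /lam1 -/sc.
by field; rewrite !gt_eqF.
Qed.

Lemma scale_nu1 (mu : V) : nu1 f mu * lam1 = lam2 / kappa * lin_mu f 1 0 mu.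
Proof.
rewrite /nu1 -kappaV /lam2 /lin_mu.
move: (coef_b f 1 0 0 * _ + _) lam1 => b l; have := lt0r_neq0 kappa_gt0.
by move: kappa => k k0; field.
Qed.

Lemma scale_nu2 (mu : V) :
  nu2 f mu * lam2 = lam2 / kappa * (lin_mu f 0 0 mu + lin_mu f 1 1 mu).
Proof.
rewrite /nu2 -kappaV /lin_mu.
move: (coef_b f 0 0 0) (coef_b f 0 0 1) (coef_b f 1 1 0) (coef_b f 1 1 1) lam2.
move: (mu 0 0) (mu 0 1) kappa => m n k b1 b2 b3 b4 l.
by ring.
Qed.

Lemma is_derive_zforce (q : W) (om : R) (v : V) :
  is_derive q ((v, (0, 0, om)) : W) (fun q : W => zforce g q.2) (q.2.1.2 * (om * gdot g q.2.2)).
Proof.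
have h1 : is_derive q ((v, (0, 0, om)) : W) (fun q : W => q.2.1.2) 0.
  exact: (is_derive_lin q (v, (0, 0, om)) (@eps_continuous R)).
have h2 : is_derive q ((v, (0, 0, om)) : W) (fun q : W => g (0, q.2.2) 0 0) (om * gdot g q.2.2).
  have dl := linear_differentiable q (@phase_continuous R).
  have dg : differentiable g (phase_lin R q) by exact: Cclass_differentiable g_C2.
  have dgl := @differentiable_comp _ _ _ _ (phase_lin R) g q dl dg.
  have dcg := @differentiable_comp _ _ _ _ _ (@coord R 2 0) q dgl
    (linear_differentiable _ (@coord_lin_continuous R 2 0)).
  apply: DeriveDef; first by apply: diff_derivable; exact: dcg.
  rewrite (derive_postlin (L := @coord R 2 0) _ (@coord_lin_continuous R 2 0) dgl).
  rewrite (deriveE _ dgl) (diff_comp dl dg)/= (diff_lin q (@phase_continuous R)).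
  rewrite /gdot (deriveE _ dg).
  have -> : phase_lin R (v, (0, 0, om)) = om *: ((0, 1) : V * R).
    by rewrite -[RHS]/(om *: 0, om *: 1) scaler0 /GRing.scale/= mulr1.
  by rewrite linearZ /coord mxE.
by apply: (is_derive_eq (is_deriveMp h1 h2)); rewrite mulr0 addr0.
Qed.

Lemma is_derive_coord (q : W) (v : V) (w : V * R * R) (j : 'I_2) :
  is_derive q ((v, w) : W) (fun q : W => q.1 0 j) (v 0 j).
Proof. exact: (is_derive_lin q (v, w) (@x_continuous R j)). Qed.

Lemma is_derive_lin_mu (q : W) (v : V) (om : R) (j k : 'I_2) :
  is_derive q ((v, (0, 0, om)) : W) (fun q : W => lin_mu f j k q.2.1.1) 0.
Proof.
have h (l : 'I_2) : is_derive q ((v, (0, 0, om)) : W) (fun q : W => q.2.1.1 0 l) 0.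
  have hl := is_derive_lin q (v, (0, 0, om)) (@mu_continuous R l).
  by apply: (is_derive_eq hl); rewrite /= /coord mxE.
rewrite /lin_mu; move: (coef_b f j k 0) (coef_b f j k 1) => a b.
have hh := is_deriveDp (is_deriveMp (is_deriveC _ _ a) (h 0))
  (is_deriveMp (is_deriveC _ _ b) (h 1)).
by apply: (is_derive_eq hh); rewrite !mulr0 !addr0.
Qed.

Definition dom_Phi : W -> Prop := change_dom nf_al nf_be nf_e nf_A nf_B mu1.

Lemma derive_Phi (q : W) (om : R) : dom_Phi q -> differentiable Phi q ->
  'D_((vfield f g q, (0, 0, om)) : W) Phi q = row2 (lam1 * ydot1 q) (lam2 * ydot2 q om).
Proof.
move=> [h1 h2 h3 h4 h5] dPhi.
have comp j : 'D_((vfield f g q, (0, 0, om)) : W) Phi q 0 j =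
    'D_((vfield f g q, (0, 0, om)) : W) (fun q => Phi q 0 j) q.
  by rewrite (derive_postlin (L := @coord R 2 j) _ (@coord_lin_continuous R 2 j) dPhi).
have hu := is_derive_coord q (vfield f g q) (0, 0, om) 0.
have hv := is_derive_coord q (vfield f g q) (0, 0, om) 1.
have dl := linear_differentiable q (@x_continuous R 0).
have hY1 := is_derive_new1 nf_e dl hu hv h1 h2.
have hY2 := is_derive_new2 nf_A cf30 hv (is_derive_zforce q om _)
  (is_derive_lin_mu q (vfield f g q) om 0 0) (is_derive_lin_mu q (vfield f g q) om 0 1) hY1 h4.
rewrite -[LHS]row2_coord !comp; congr row2.
  have E : (fun q => Phi q 0 0) = (fun q : W => lam1 * new1 nf_al nf_be nf_e (q.1 0 0) (q.1 0 1)).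
    by apply/funext => p; rewrite /Phi /change row2E0.
  rewrite E; have hh := is_deriveMp (is_deriveC q _ lam1) hY1.
  by rewrite (derive_val (is_derive := hh)) mulr0 addr0.
have E : (fun q => Phi q 0 1) = (fun q : W => lam2 * new2 nf_al nf_be nf_e nf_A nf_B cf30
  (q.1 0 0) (q.1 0 1) (mu0 q.2) (mu1 q.2) (zforce g q.2)).
  by apply/funext => p; rewrite /Phi /change row2E1.
rewrite E; have hh := is_deriveMp (is_deriveC q _ lam2) hY2.
by rewrite (derive_val (is_derive := hh)) mulr0 addr0.
Qed.

(** Right-hand side of the second equation of the normal form, before scaling. *)
Definition nform2 (q : W) : R :=
  lin_mu f 1 0 q.2.1.1 * Y1 q + (mu0 q.2 + lin_mu f 1 1 q.2.1.1) * Y2 q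
  + coef_c f * Y1 q ^+ 3 + coef_d f * Y1 q ^+ 2 * Y2 q + q.2.1.2 * g (0, q.2.2) 0 1.

(** What the normal form misses, in the old coordinates. *)
Definition error (q : W) (om : R) : V :=
  row2 (lam2 * (ydot1 q - Y2 q)) (lam2 / kappa * (ydot2 q om - nform2 q)).

Let rescale_equation (ki l1 l2 n1 n2 c d s1 s2 F k a b cc dd y1 y2 yd e gg : R) :
  n1 * l1 = k * a -> n2 * l2 = k * b -> k * cc = s1 * l1 ^+ 3 ->
  k * dd = s2 * l1 ^+ 2 * l2 -> F = k -> k = l2 * ki ->
  ki * (l2 * yd) - (n1 * (l1 * y1) + n2 * (l2 * y2) + s1 * (l1 * y1) ^+ 3
    + s2 * (l1 * y1) ^+ 2 * (l2 * y2) + e * (F * gg)) =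
  k * (yd - (a * y1 + b * y2 + cc * y1 ^+ 3 + dd * y1 ^+ 2 * y2 + e * gg)).
Proof.
move=> h1 h2 h3 h4 -> hk.
transitivity (l2 * ki * yd - (n1 * l1 * y1 + n2 * l2 * y2 + s1 * l1 ^+ 3 * y1 ^+ 3
  + s2 * l1 ^+ 2 * l2 * (y1 ^+ 2 * y2) + e * (k * gg))); first by ring.
by rewrite h1 h2 -h3 -h4 -hk; ring.
Qed.

Lemma error_eq (q : W) (om : R) : dom_Phi q -> differentiable Phi q ->
  kappa^-1 *: 'D_((vfield f g q, (0, 0, om)) : W) Phi q
    - normal_form f g q.2.1.1 q.2.1.2 q.2.2 (Phi q) = error q om.
Proof.
move=> hq dPhi; rewrite derive_Phi//.
have P0 : Phi q 0 0 = lam1 * Y1 q by rewrite /Phi /change row2E0.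
have P1 : Phi q 0 1 = lam2 * Y2 q by rewrite /Phi /change row2E1.
rewrite -[LHS]row2_coord /error; congr row2.
  rewrite /normal_form mxE [X in X + _]mxE row2E0 [X in _ + X]mxE [X in - X]mxE /= P1.
  by rewrite mulrBr /lam2; congr (_ - _); rewrite mulrCA mulrA.
rewrite /normal_form mxE [X in X + _]mxE row2E1 [X in _ + X]mxE [X in - X]mxE /= P0 P1.
rewrite /forcing scale_forcing /nform2 /mu0.
exact: rescale_equation (scale_nu1 _) (scale_nu2 _) scale_c scale_d erefl _.
Qed.

Let nx (p : W * R) := `|px p|.
Let nm (p : W * R) := `|pmu p|.
Let ne (p : W * R) := `|peps p|.
Let N3 p := nx p ^+ 3 + nm p * nx p + ne p.

Lemma coef_dE : coef_d f = cq21 + 3 * cf30.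
Proof.
rewrite /coef_d /cq21 /cf30; move: (coef_a f 1 2 1) (coef_a f 0 3 0) => a b.
by field.
Qed.

Lemma vfield_small0 : small (origin R) N3 (fun p => vfield f g p.1 0 0 -
  (px p 0 1 + (mu0 p.1.2 * px p 0 0 + mu1 p.1.2 * px p 0 1 + (cf30 * px p 0 0 ^+ 3
   + cf21 * px p 0 0 ^+ 2 * px p 0 1 + cf12 * px p 0 0 * px p 0 1 ^+ 2 + cf03 * px p 0 1 ^+ 3)
   + zforce g p.1.2))).
Proof.
apply: small_ext (vfield_small f_C4 f_odd f_lin g_C2 g_per 0) => p.
by rewrite mul1r /cubic -!addrA.
Qed.

Lemma vfield_small1 : small (origin R) N3 (fun p => vfield f g p.1 0 1 -
  (lin_mu f 1 0 (pmu p) * px p 0 0 + lin_mu f 1 1 (pmu p) * px p 0 1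
   + (coef_c f * px p 0 0 ^+ 3
   + cq21 * px p 0 0 ^+ 2 * px p 0 1 + cq12 * px p 0 0 * px p 0 1 ^+ 2 + cq03 * px p 0 1 ^+ 3)
   + peps p * g (0, pphi p) 0 1)).
Proof.
apply: small_ext (vfield_small f_C4 f_odd f_lin g_C2 g_per 1) => p.
by rewrite mul0r add0r /cubic -!addrA.
Qed.

Let nx_ge0 p : 0 <= nx p. Proof. exact: normr_ge0. Qed.
Let nm_ge0 p : 0 <= nm p. Proof. exact: normr_ge0. Qed.
Let ne_ge0 p : 0 <= ne p. Proof. exact: normr_ge0. Qed.

Lemma error_small : small (origin R) N3 (fun p => `|error p.1 (pom p)|).
Proof.
have bz := forcing_big g_C2 g_per.
have bm := lin_mu_big f.
have e1 := first_equation nx_ge0 nm_ge0 ne_ge0 (@vanishes_x R) (@vanishes_mu R)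
  (big_coord R 0) (big_coord R 1) (bm 0 0) (bm 0 1) (bm 1 0) (bm 1 1) (bz 0) (bz 1)
  vfield_small0 vfield_small1.
have e2 := second_equation nx_ge0 nm_ge0 ne_ge0 (@vanishes_x R) (@vanishes_mu R)
  (big_coord R 0) (big_coord R 1) (bm 0 0) (bm 0 1) (bm 1 0) (bm 1 1) (bz 0) (bz 1)
  (zdot_small g_C2 g_per) vfield_small0 vfield_small1.
have s1 := smallZ lam2 e1.
have s2 := smallZ (lam2 / kappa) e2.
move=> d dpos; apply: filterS2 (s1 d dpos) (s2 d dpos) => p h1 h2.
rewrite normr_id; apply: norm_row2_le.
  by rewrite row2E0; exact: h1.
rewrite row2E1 /nform2 coef_dE; exact: h2.
Qed.

Lemma dom_Phi_near : exists2 r, 0 < r & forall q, tube r q -> dom_Phi q.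
Proof.
have /near_originP[r r0 rP] := dom_new_near cf21 cf12 cf03 cq12 cq03 nx_ge0 nm_ge0
  (@vanishes_x R) (@vanishes_mu R) (big_coord R 0) (big_coord R 1) (lin_mu_big f 0 1).
by exists r => // q tq; apply: (rP (q, 0)) => //=; rewrite normr0.
Qed.

Definition dom_Psi : W -> Prop :=
  unchange_dom nf_al nf_be nf_e nf_A nf_B cf30 lam1 lam2 mu0 mu1 (zforce g).

(** Points with small new coordinates come from small old ones. *)
Lemma Psi_near : exists2 C, 1 <= C & exists2 r, 0 < r & forall q, tube r q ->
  dom_Psi q /\ `|(Psi q).1| <= C * (`|q.1| + `|q.2.1.2|).
Proof.
have by1 : big (origin R) nx (fun p => px p 0 0 / lam1).
  by apply: bigMr; [exact: big_coord|exact: big_cst].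
have by2 : big (origin R) nx (fun p => px p 0 1 / lam2).
  by apply: bigMr; [exact: big_coord|exact: big_cst].
have bz := forcing_big g_C2 g_per 0.
have bm := lin_mu_big f.
have [C1 C10 h1] := old1_big nf_al nf_be nf_e nf_A nf_B cf30 nx_ge0 ne_ge0
  (@vanishes_x R) (@vanishes_mu R) (@vanishes_eps R) by1 by2 (bm 0 0) (bm 0 1) bz.
have [C2 C20 h2] := old2_big nf_A nf_B cf30 nx_ge0 ne_ge0
  (@vanishes_x R) (@vanishes_mu R) (@vanishes_eps R) by1 by2 (bm 0 0) (bm 0 1) bz.
have h3 := dom_old_near nf_al nf_be nf_e nf_A nf_B cf30 nx_ge0 ne_ge0
  (@vanishes_x R) (@vanishes_mu R) (@vanishes_eps R) by1 by2 (bm 0 0) (bm 0 1) bz.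
exists (C1 + C2 + 1); first by lra.
have [r r0 rP] := (near_originP _).1 (filterI h1 (filterI h2 h3)).
exists r => // q tq; have := rP (q, 0) tq; rewrite normr0 => /(_ r0)[] /= k1 [k2 k3].
split; first exact: k3.
have N0 : 0 <= nx (q, 0) + ne (q, 0) by rewrite addr_ge0.
move: k1 k2; rewrite [in X in X -> _](ger0_norm N0) => k1.
rewrite [in X in X -> _](ger0_norm N0) => k2.
rewrite -/(px (q, 0)) -/(nx (q, 0)) -[`|q.2.1.2|]/(ne (q, 0)).
apply: norm_row2_le.
  by rewrite row2E0; apply: le_trans k1 _; apply: ler_wpM2r => //; lra.
by rewrite row2E1; apply: le_trans k2 _; apply: ler_wpM2r => //; lra.
Qed.

Lemma tube_open (r : R) : open (@tube R r).
Proof.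
rewrite openE => q [h1 h2 h3].
have c1 : {for q, continuous (fun q : W => `|q.1|)}.
  by apply: continuous_comp; [exact: fst_continuous|exact: norm_continuous].
have c2 : {for q, continuous (fun q : W => `|q.2.1.1|)}.
  apply: continuous_comp; last exact: norm_continuous.
  apply: continuous_comp; last exact: (@fst_continuous R V R).
  apply: continuous_comp; last exact: (@fst_continuous R (V * R)%type R).
  exact: (@snd_continuous R V (V * R * R)%type).
have c3 : {for q, continuous (fun q : W => `|q.2.1.2|)}.
  by apply: continuous_comp; [exact: (@eps_continuous R)|exact: norm_continuous].
have lt_near (h : W -> R) : {for q, continuous h} -> h q < r -> \forall q' \near q, h q' < r.
  by move=> hc hq; exact: (@cvgr_lt _ _ (nbhs q) _ h (h q) hc r hq).
apply: filterS3 (lt_near _ c1 h1) (lt_near _ c2 h2) (lt_near _ c3 h3) => q'.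
by split.
Qed.

Let Cmu0 : Cclass 2 (fun q : W => mu0 q.2). Proof. exact: lin_mu_Cclass. Qed.
Let Cmu1 : Cclass 2 (fun q : W => mu1 q.2). Proof. exact: lin_mu_Cclass. Qed.
Let Cz := zforce_Cclass g_C2.

Lemma Phi_diffeo (r : R) : (forall q, tube r q -> dom_Phi q) ->
  [/\ open ((fun q => (Phi q, q.2)) @` tube r),
      Cclass_on 2 (tube r) (fun q => (Phi q, q.2)),
      Cclass_on 2 ((fun q => (Phi q, q.2)) @` tube r) Psi &
      forall q, tube r q -> Psi (Phi q, q.2) = q].
Proof. exact: change_diffeo lam1_neq0 lam2_neq0 Cmu0 Cmu1 Cz _ (@tube_open r). Qed.

Lemma Phi_differentiable (r : R) q : (forall q, tube r q -> dom_Phi q) ->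
  tube r q -> differentiable Phi q.
Proof.
move=> rP tq.
have [_ [dF _] _ _] := Phi_diffeo rP.
exact: (@differentiable_comp _ _ _ _ _ fst q (dF q tq)
  (linear_differentiable _ (@fst_continuous R V (V * R * R)%type))).
Qed.

Lemma Phi_local_coordinates (r : R) : 0 < r -> (forall q, tube r q -> dom_Phi q) ->
  local_coordinates r Phi.
Proof.
move=> r0 rP; split=> //.
- by exists Psi; exact: Phi_diffeo.
- move=> phi; rewrite /Phi /change /=.
  rewrite /zforce /= mul0r /new2 /new1 !mxE !mul0r /=.
  rewrite expr0n /= !mulr0 !addr0 !mulr0.
  by apply/rowP => i; rewrite !mxE; case: ifP.
- move=> x mu eps phi _; rewrite /Phi /change /=.
  by rewrite /zforce /= g_per.
Qed.

(** The transported field minus the normal form, in the new coordinates. *)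
Definition remainder (y : V) (phi : R) (mu : V) (eps om : R) : V :=
  kappa^-1 *: 'D_((vfield f g (Psi (y, (mu, eps, phi))), (0, 0, om)) : W) Phi
      (Psi (y, (mu, eps, phi))) - normal_form f g mu eps phi y.

Let cube_sum (a b : R) : 0 <= a -> 0 <= b -> (a + b) ^+ 3 <= 4 * (a ^+ 3 + b ^+ 3).
Proof.
move=> a0 b0; rewrite -subr_ge0.
have -> : 4 * (a ^+ 3 + b ^+ 3) - (a + b) ^+ 3 = 3 * ((a + b) * (a - b) ^+ 2) by ring.
by rewrite mulr_ge0// mulr_ge0 ?sqr_ge0// addr_ge0.
Qed.

(* As [|x| <= C (|y| + eps)], the gauge in [x] is bounded by the gauge in [y]. *)
Let gauge_bound (C x y m e : R) : 0 < C -> 0 <= x -> 0 <= y -> 0 <= m -> m <= 1 ->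
  0 <= e -> e <= 1 -> x <= C * (y + e) ->
  x ^+ 3 + m * x + e <= (4 * C ^+ 3 + C + 1) * (y ^+ 3 + m * y + e).
Proof.
move=> C0 x0 y0 m0 m1 e0 e1 xC.
have C3 : 0 <= C ^+ 3 by rewrite exprn_ge0// ltW.
have x3 : x ^+ 3 <= 4 * C ^+ 3 * (y ^+ 3 + e).
  apply: (@le_trans _ _ ((C * (y + e)) ^+ 3)).
    by rewrite lerXn2r// nnegrE (le_trans x0).
  rewrite exprMn [4 * C ^+ 3]mulrC -[leRHS]mulrA; apply: ler_wpM2l => //.
  apply: le_trans (cube_sum y0 e0) _; rewrite ler_pM2l// lerD2l.
  by rewrite -[leRHS]expr1 ler_wiXn2l.
have mx : m * x <= C * (m * y + e).
  apply: le_trans (ler_wpM2l m0 xC) _.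
  rewrite mulrCA; apply: ler_wpM2l; first exact: ltW.
  by rewrite mulrDr lerD2l ler_piMl.
have y3 : 0 <= y ^+ 3 by rewrite exprn_ge0.
have my : 0 <= m * y by rewrite mulr_ge0.
have h1 : 0 <= C ^+ 3 * (m * y) by rewrite mulr_ge0.
have h2 : 0 <= C * y ^+ 3 by rewrite mulr_ge0// ltW.
lra.
Qed.

Lemma remainder_higher_order (r0 : R) : 0 < r0 ->
  (forall q, tube r0 q -> dom_Phi q) -> higher_order remainder.
Proof.
move=> r0pos r0P delta dpos.
have [C C1 [r1 r1pos back]] := Psi_near.
have C0 : 0 < C by lra.
pose K := 4 * C ^+ 3 + C + 1.
have K0 : 0 < K by rewrite /K; have := exprn_gt0 3 C0; lra.
have dK : 0 < delta / K by rewrite divr_gt0.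
have /near_originP[r2 r2pos err] := error_small dK.
pose m := Num.min (Num.min r0 r1) (Num.min r2 1).
have m0 : 0 < m by rewrite !lt_min r0pos r1pos r2pos /=.
have [m_0 m_1 m_2 m_3] : [/\ m <= r0, m <= r1, m <= r2 & m <= 1].
  by rewrite /m; split; rewrite !ge_min lexx ?orbT.
(* By [Psi_near] the old coordinates are then smaller than [m]. *)
exists (m / (2 * C)); first by rewrite divr_gt0// mulr_gt0.
move=> y phi mu eps om hy hmu /andP[eps0 heps] /andP[om0 hom].
have mC : m / (2 * C) <= m by rewrite ler_pdivrMr ?mulr_gt0//; nra.
have [hdom hb] : dom_Psi (y, (mu, eps, phi)) /\
    `|(Psi (y, (mu, eps, phi))).1| <= C * (`|y| + `|eps|).
  by apply: back; split=> /=; rewrite ?(gtr0_norm eps0); lra.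
set q := Psi (y, (mu, eps, phi)) in hb *.
have q2 : q.2 = (mu, eps, phi) by [].
have PhiE : Phi q = y by exact: (unchangeK lam1_neq0 lam2_neq0 hdom).
rewrite (gtr0_norm eps0) in hb.
have qm : `|q.1| < m.
  apply: le_lt_trans hb _.
  have -> : m = C * (m / (2 * C) + m / (2 * C)) by field; lra.
  by rewrite ltr_pM2l//; lra.
have tq s : m <= s -> tube s q.
  by move=> ms; split; rewrite ?q2 /= ?(gtr0_norm eps0); lra.
have dq := r0P q (tq _ m_0).
have dPhi := Phi_differentiable r0P (tq _ m_0).
rewrite /remainder -/q.
have -> : kappa^-1 *: 'D_((vfield f g q, (0, 0, om)) : W) Phi q - normal_form f g mu eps phi y
   = error q om by rewrite -error_eq// PhiE q2.
have := err (q, om) (tq _ m_2) _; rewrite /= (gtr0_norm om0) => /(_ _)/le_trans.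
rewrite normr_id; apply; first by lra.
have ->: N3 (q, om) = `|q.1| ^+ 3 + `|mu| * `|q.1| + eps.
  by rewrite /N3 /nx /nm /ne /px /pmu /peps /= (gtr0_norm eps0).
have x0 := normr_ge0 q.1; have mu_0 := normr_ge0 mu; have y_0 := normr_ge0 y.
rewrite ger0_norm; last by rewrite !addr_ge0 ?exprn_ge0 ?mulr_ge0// ltW.
have eps1 : eps <= 1 by apply: le_trans m_3; apply: le_trans mC; exact: ltW.
have mu1 : `|mu| <= 1 by apply: le_trans m_3; apply: le_trans mC; exact: ltW.
have gb := gauge_bound C0 x0 y_0 mu_0 mu1 (ltW eps0) eps1 hb.
have -> : delta * (`|y| ^+ 3 + `|mu| * `|y| + eps) =
  delta / K * (K * (`|y| ^+ 3 + `|mu| * `|y| + eps)) by field; exact: lt0r_neq0.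
by apply: ler_wpM2l; [exact: ltW|exact: gb].
Qed.

(** At each time, the curve [x] has the velocity of the field exactly when its image, run
    at the rescaled time, has that of the normal form plus the remainder. *)
Lemma conjugacy_at (r : R) (mu : V) (eps om : R) (x : R -> V) (t : R) :
  (forall q, tube r q -> dom_Phi q) -> `|mu| < r -> 0 < eps < r ->
  (\forall s \near t, `|x s| < r) ->
  is_derive t 1 x (f (x t, mu) + eps *: g (x t, om * t)) <->
  is_derive (kappa * t) 1 (fun tau => Phi (x (tau / kappa), (mu, eps, kappa^-1 * om * tau)))
    (normal_form f g mu eps (kappa^-1 * om * (kappa * t))
        (Phi (x (kappa * t / kappa), (mu, eps, kappa^-1 * om * (kappa * t))))
     + remainder (Phi (x (kappa * t / kappa), (mu, eps, kappa^-1 * om * (kappa * t))))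
         (kappa^-1 * om * (kappa * t)) mu eps om).
Proof.
move=> rP mr /andP[eps0 er] xr.
have k0 : kappa != 0 := lt0r_neq0 kappa_gt0.
have tE : kappa * t / kappa = t by rewrite mulrAC divff// mul1r.
have phE s : kappa^-1 * om * (kappa * s) = om * s by rewrite mulrC -mulrA mulrCA mulVKf// mulrC.
(* At the time [kappa * t] the rescaled curve has the phase [om * t]. *)
rewrite tE phE.
have [Fo [dF _] [dG _] PsiK] := Phi_diffeo rP.
pose p (s : R) : V * R * R := (mu, eps, om * s).
have tube_near : \forall s \near t, tube r (x s, p s).
  by apply: filterS xr => s xs; split => //=; rewrite gtr0_norm.
have tq := nbhs_singleton tube_near.
have dp : is_derive t 1 p (0, 0, om).
  apply: (is_derive_pair (a := fun=> (mu, eps)) (b := fun s => om * s)).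
  have := is_deriveZ om (is_derive_id t (1 : R)).
  by rewrite /GRing.scale/= mulr1.
set v := f (x t, mu) + _.
have T := is_derive_transport (@tube_open r) dF (fun q tq => dG _ (imageP _ tq))
  (fun q tq => PsiK q (set_mem tq)) v tube_near dp.
set D := 'D_(v, (0, 0, om)) Phi (x t, p t) in T.
have valE : normal_form f g mu eps (om * t) (Phi (x t, p t))
    + remainder (Phi (x t, p t)) (om * t) mu eps om = kappa^-1 *: D.
  rewrite /remainder; have -> := PsiK _ tq.
  by rewrite addrC subrK.
rewrite valE; rewrite T; split => h.
  have := @is_derive_rescale _ _ (fun s => Phi (x s, p s)) kappa^-1 (kappa * t) D.
  rewrite tE => /(_ h); congr is_derive.
  by apply/funext => s; rewrite /p -mulrA [s * _]mulrC mulrCA.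
have := @is_derive_rescale _ _ (fun tau => Phi (x (tau / kappa), (mu, eps, kappa^-1 * om * tau)))
  kappa t (kappa^-1 *: D).
rewrite mulrC in h; move=> /(_ h); rewrite scalerA divff// scale1r; congr is_derive.
by apply/funext => s; rewrite mulfK// [s * _]mulrC phE.
Qed.

End Main.

Lemma forcing_mean0 (R : realType) (f : 'rV[R]_2 * 'rV[R]_2 -> 'rV[R]_2)
    (g : 'rV[R]_2 * R -> 'rV[R]_2) : Cclass 2 g ->
  \int[lebesgue_measure]_(phi in `[0, 2 * pi]) (g (0, phi) 0 1) = 0 ->
  \int[lebesgue_measure]_(phi in `[0, 2 * pi]) forcing f g phi = 0.
Proof.
move=> g_C2 g0; rewrite /forcing RintegralZl//= ?g0 ?mulr0//.
apply: continuous_compact_integrable; first exact: segment_compact.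
apply: continuous_subspaceT => phi.
have c1 := @inj2_continuous R 'rV[R]_2 R phi.
have c2 := Cclass_on_continuous g_C2 (I : setT (inj2 'rV[R]_2 phi)).
have c3 := @coord_lin_continuous R 2 1 (g (inj2 _ phi)).
exact: (cvg_comp _ _ (cvg_comp _ _ c1 c2) c3).
Qed.

Theorem proposition2p1 (R : realType)
  (f : 'rV[R]_2 * 'rV[R]_2 -> 'rV[R]_2) (g : 'rV[R]_2 * R -> 'rV[R]_2)
  (f_C4 : Cclass 4 f)
  (f_odd : forall x mu, f (- x, mu) = - f (x, mu))
  (* the library's jacobian acts on row vectors, hence the transpose *)
  (f_lin : (jacobian (fun x => f (x, 0)) 0)^T = delta_mx 0 1)
  (g_C2 : Cclass 2 g)
  (g_per : forall x phi, g (x, phi + 2 * pi) = g (x, phi))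
  (g_mean : forall x (j : 'I_2),
     \int[lebesgue_measure]_(phi in `[0, 2 * pi]) (g (x, phi) 0 j) = 0)
  (c_neq0 : coef_c f != 0) (d_neq0 : coef_d f != 0) :
  (exists (r : R) (Phi : 'rV[R]_2 * ('rV[R]_2 * R * R) -> 'rV[R]_2)
          (E : 'rV[R]_2 -> R -> 'rV[R]_2 -> R -> R -> 'rV[R]_2),
    [/\ local_coordinates r Phi,
        higher_order E &
        forall (mu : 'rV[R]_2) (eps omega : R),
          `|mu| < r -> 0 < eps < r -> 0 < omega ->
        forall (a b : R) (x : R -> 'rV[R]_2),
          (forall t, t \in `]a, b[ -> `|x t| < r) ->
          let kappa := `|coef_c f / coef_d f| in
          let omegabar := `|coef_d f / coef_c f| * omega in
          solves_on (fun t z => f (z, mu) + eps *: g (z, omega * t))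
            `]a, b[ x
          <->
          solves_on (fun tau y =>
              normal_form f g mu eps (omegabar * tau) y
              + E y (omegabar * tau) mu eps omega)
            `](kappa * a), (kappa * b)[
            (fun tau => Phi (x (tau / kappa), (mu, eps, omegabar * tau)))]) /\
  \int[lebesgue_measure]_(phi in `[0, 2 * pi]) forcing f g phi = 0.
Proof.
have g1 := g_mean 0 1.
split; last exact: forcing_mean0.
have [r r0 rP] := dom_Phi_near f.
exists r, (Phi f g), (remainder f g); split.
- exact: Phi_local_coordinates.
- exact: (remainder_higher_order f_C4 f_odd f_lin g_C2 g_per c_neq0 d_neq0 r0 rP).
move=> mu eps omega mur epsr omega0 a b x xr kap omegabar.
have k0 : 0 < kap := kappa_gt0 c_neq0 d_neq0.
have obE : omegabar = (kappa f)^-1 * omega by rewrite /omegabar kappaV.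
have near_x t : t \in `]a, b[ -> \forall s \near t, `|x s| < r.
  by move=> /near_in_itvoo; apply: filterS => s; exact: xr.
have conj t (tI : t \in `]a, b[) :=
  conjugacy_at g_C2 c_neq0 d_neq0 omega rP mur epsr (near_x t tI).
rewrite obE; split => sol t /= tI.
  have tk : t / kap \in `]a, b[.
    move: tI; rewrite !in_itv/= => /andP[h1 h2].
    by rewrite ltr_pdivlMr// ltr_pdivrMr// ![_ * kap]mulrC h1.
  have := (conj _ tk).1 (sol _ tk).
  by rewrite [kappa f * _]mulrC -/kap divfK ?gt_eqF.
have tk : kap * t \in `](kap * a), (kap * b)[.
  by move: tI; rewrite !in_itv/= !ltr_pM2l.
exact: (conj t tI).2 (sol _ tk).
Qed.
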